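(* Let $F\colon S(n)\to\mathbb{R}$ be degenerate elliptic and sublinear, and assume that there exists $X\in S(n)$ such that $F(X)<0$. Let $\Omega\subseteq\mathbb{R}^n$ be nonempty and open, and assume that $u$ is a viscosity supersolution and $v$ is a viscosity subsolution of the PDE $F(\mathcal{H}w)=0$ in $\Omega$. Let $D\subset\subset\Omega$ (i.e. $\overline{D}$ is compact and contained in $\Omega$). Then \[v|_{\partial D}\leq u|_{\partial D}\qquad\Rightarrow\qquad v\leq u\quad\text{in } D.\]
   Context: Here $n\geq 2$ and $S(n)$ is the space of symmetric real $n\times n$ matrices, partially ordered by $X\leq Y$ iff $\xi^TX\xi\leq\xi^TY\xi$ for all $\xi\in\mathbb{R}^n$. $\mathcal{H}w$ denotes the Hessian matrix of $w$. A function $F\colon S(n)\to\mathbb{R}$ is sublinear if $F(X+Y)\leq F(X)+F(Y)$ and $F(tX)=tF(X)$ for all $X,Y\in S(n)$ and $t\geq 0$; it is degenerate elliptic if $X\leq Y$ implies $F(X)\leq F(Y)$. A viscosity supersolution of $F(\mathcal{H}w)=0$ in $\Omega$ is a function $u\colon\Omega\to(-\infty,\infty]$ that is lower semicontinuous, finite on a dense subset of $\Omega$, and such that whenever $x_0\in\Omega$ and a $C^2$ function $\phi$ satisfies $\phi(x_0)=u(x_0)$ and $\phi\leq u$ near $x_0$, then $F(\mathcal{H}\phi(x_0))\leq 0$. A viscosity subsolution is a function $v\colon\Omega\to[-\infty,\infty)$ that is upper semicontinuous, finite on a dense subset of $\Omega$, and such that whenever $x_0\in\Omega$ and a $C^2$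 function $\phi$ satisfies $\phi(x_0)=v(x_0)$ and $\phi\geq v$ near $x_0$, then $F(\mathcal{H}\phi(x_0))\geq 0$. *)

(* Defs.v *)
From HB Require Import structures.
From mathcomp Require Import all_boot all_order all_algebra.
From mathcomp Require Import all_classical all_reals all_analysis.

Set Implicit Arguments.
Unset Strict Implicit.
Unset Printing Implicit Defensive.
Import Order.TTheory GRing.Theory Num.Theory.
Import numFieldNormedType.Exports.
Local Open Scope classical_set_scope.
Local Open Scope ring_scope.

(* Points of R^n are row vectors, so the quadratic form of X at xi is
   xi X xi^T.  A function F : S(n) -> R is represented by a function on all
   square matrices whose values outside the symmetric ones are never used. *)

Section SymmetricMatrices.
Context {R : realType} {n : nat}.

Definition qform (X : 'M[R]_n) (xi : 'rV[R]_n) : R := (xi *m X *m xi^T) 0 0.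

Definition loewner_le (X Y : 'M[R]_n) : Prop :=
  forall xi : 'rV[R]_n, qform X xi <= qform Y xi.

Definition sublinear (F : 'M[R]_n -> R) : Prop :=
  (forall X Y, X \is symmetricmx -> Y \is symmetricmx ->
     F (X + Y) <= F X + F Y) /\
  (forall X (t : R), X \is symmetricmx -> 0 <= t -> F (t *: X) = t * F X).

Definition degenerate_elliptic (F : 'M[R]_n -> R) : Prop :=
  forall X Y, X \is symmetricmx -> Y \is symmetricmx ->
    loewner_le X Y -> F X <= F Y.

End SymmetricMatrices.

Section C2.
Context {R : realType} {n : nat}.
Implicit Types (U : set 'rV[R]_n) (f : 'rV[R]_n -> R).

Definition partial (i : 'I_n) f (x : 'rV[R]_n) : R := 'D_(delta_mx 0 i) f x.

(* For open U: f has continuous partial derivatives up to order k on U.  The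
   derivability clause is needed since 'D_v f x is total. *)
Fixpoint Ck_on (k : nat) U f : Prop :=
  (forall x, U x -> {for x, continuous f}) /\
  if k is k'.+1 then
    forall i : 'I_n, (forall x, U x -> derivable f x (delta_mx 0 i)) /\
                     Ck_on k' U (partial i f)
  else True.

Definition C2_near (x : 'rV[R]_n) f : Prop :=
  exists2 U, open_nbhs x U & Ck_on 2 U f.

Definition hessian f (x : 'rV[R]_n) : 'M[R]_n :=
  \matrix_(i, j) partial i (partial j f) x.

End C2.

Definition upper_semicontinuous {X : topologicalType} {R : realFieldType}
    (f : X -> \bar R) : Prop :=
  forall x a, (f x < a%:E)%E ->
    exists2 V, nbhs x V & forall y, V y -> (f y < a%:E)%E.

Section Viscosity.
Context {R : realType} {n : nat}.
Implicit Types (F : 'M[R]_n -> R) (Omega : set 'rV[R]_n).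

Definition finite_on_dense Omega (u : 'rV[R]_n -> \bar R) : Prop :=
  Omega `<=` closure (Omega `&` [set x | u x \is a fin_num]).

(* Functions on Omega are total functions whose values outside Omega are
   irrelevant: in [subspace Omega] the points outside Omega are isolated, so
   semicontinuity there only concerns the restriction to Omega. *)

Definition viscosity_supersolution F Omega (u : 'rV[R]_n -> \bar R) : Prop :=
  [/\ forall x, Omega x -> u x != -oo%E,
      lower_semicontinuous (u : subspace Omega -> \bar R),
      finite_on_dense Omega u &
      forall (x0 : 'rV[R]_n) (phi : 'rV[R]_n -> R),
        Omega x0 -> C2_near x0 phi ->
        (phi x0)%:E = u x0 ->
        (\forall x \near x0, ((phi x)%:E <= u x)%E) ->
        F (hessian phi x0) <= 0].

Definition viscosity_subsolution F Omega (v : 'rV[R]_n -> \bar R) : Prop :=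
  [/\ forall x, Omega x -> v x != +oo%E,
      upper_semicontinuous (v : subspace Omega -> \bar R),
      finite_on_dense Omega v &
      forall (x0 : 'rV[R]_n) (phi : 'rV[R]_n -> R),
        Omega x0 -> C2_near x0 phi ->
        (phi x0)%:E = v x0 ->
        (\forall x \near x0, (v x <= (phi x)%:E)%E) ->
        0 <= F (hessian phi x0)].

End Viscosity.

Definition compactly_contained {T : topologicalType} (D Omega : set T) : Prop :=
  compact (closure D) /\ closure D `<=` Omega.

Definition boundary {T : topologicalType} (D : set T) : set T :=
  closure D `\` interior D.

(* Main.v *)
(* Idea. By finite-dimensional Hahn-Banach, F is the supremum of the linear
   functionals X |-> sum_b qform X b that it dominates, so a supersolution for F
   is a supersolution for each of these constant-coefficient operators L.  For
   one L, a continuous supersolution w satisfies w >= T^j w up to a small error,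
   where T averages w over the steps +h b and -h b of a random walk: compare w
   with the iterates under T of a smooth minorant.  This inequality passes to
   averages of translates of w, so a mollification of w is a classical
   supersolution of every L, hence of F, and no theorem on sums is needed.
   Apply this to an inf-convolution of min(u, Lam), which is continuous: if
   v > u somewhere, then v minus the mollification minus a small multiple of
   the quadratic form of X, where F X < 0, has an interior maximum, at which the
   subsolution property of v fails. *)

Require Import Defs.
From mathcomp Require Import all_boot all_order all_algebra.
From mathcomp Require Import all_classical all_reals all_analysis.
From mathcomp Require Import ring lra.
Import Order.TTheory GRing.Theory Num.Theory.
Import numFieldNormedType.Exports.
Local Open Scope classical_set_scope.
Local Open Scope ring_scope.

Set Implicit Arguments.
Unset Strict Implicit.
Unset Printing Implicit Defensive.

(** * Sublinear functions and sums of squares *)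

Section Sublinear.
Context {R : realType} {V : lmodType R}.
Implicit Types (p q : V -> R) (x y e : V).

(** The obstacle is that a viscosity inequality speaks of test functions touching at one point, and
    averaging over translates destroys touching. The walk replaces it by inequalities that are
    linear in the function, and these survive averaging. The walk argument needs maxima to exist and
    moduli of continuity to be uniform. It is therefore run on a nonnegative function with compact
    support, the positive part of a paraboloid minus w; the paraboloid costs a constant c in the
    inequality, and exactly this constant cancels when one returns to w. Mollification averages
    along coordinate segments, so that every derivative is a difference quotient and only the
    one-dimensional fundamental theorem of calculus is needed. Lam is the maximum of v over the
    closure of D, so the truncation does not disturb the boundary inequality. *)

Definition sublin p :=
  (forall x y, p (x + y) <= p x + p y) /\
  (forall t x, 0 <= t -> p (t *: x) = t * p x).

Definition aligned p x := p (- x) = - p x.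

Lemma sublin0 p : sublin p -> p 0 = 0.
Proof. by case=> _ /(_ 0 0 (lexx _)); rewrite scale0r mul0r. Qed.

Lemma sublin_ge_opp p x : sublin p -> - p (- x) <= p x.
Proof.
move=> sp; rewrite -subr_ge0 opprK -(sublin0 sp).
by rewrite -[X in p X <= _](subrr x); apply: sp.1.
Qed.

(* Lowering p to q x = inf_(t >= 0) (p (x + t e) - t p e) keeps it sublinear and
   makes it linear along e; doing so for every basis vector proves Hahn-Banach. *)
Lemma sublin_align p e : sublin p ->
  exists q, [/\ sublin q, (forall x, q x <= p x), aligned q e & q e = p e].
Proof.
move=> sp.
pose S x := [set p (x + t *: e) - t * p e | t in [set t | 0 <= t]].
have Slb x : lbound (S x) (- p (- x)).
  move=> _ [t /= t0 <-]; rewrite lerBrDr -(sp.2 _ _ t0).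
  have := sp.1 (x + t *: e) (- x); rewrite addrAC subrr add0r; lra.
have Sn0 x : S x !=set0 by exists (p (x + 0 *: e) - 0 * p e), 0 => /=.
have Sinf x : has_inf (S x) by split; [exact: Sn0 | exists (- p (- x)); exact: Slb].
pose q x := inf (S x).
have qle x t : 0 <= t -> q x <= p (x + t *: e) - t * p e.
  by move=> t0; apply: ge_inf; [exact: (Sinf x).2 | exists t].
have q_ge x a : (forall t, 0 <= t -> a <= p (x + t *: e) - t * p e) -> a <= q x.
  by move=> h; apply: lb_le_inf; [exact: Sn0 | move=> _ [t t0 <-]; exact: h].
have qp x : q x <= p x.
  by have := qle x 0 (lexx _); rewrite scale0r addr0 mul0r subr0.
have qsub x y : q (x + y) <= q x + q y.
  rewrite -lerBlDr; apply: (q_ge) => t t0.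
  rewrite lerBlDr -lerBlDl; apply: (q_ge) => s s0.
  rewrite lerBlDl; apply: le_trans (qle _ _ (addr_ge0 t0 s0)) _.
  rewrite scalerDl addrACA mulrDl opprD [leRHS]addrACA lerD2r; exact: sp.1.
have q0 : q 0 = 0.
  apply/eqP; rewrite eq_le; apply/andP; split.
    by apply: le_trans (qp 0) _; rewrite (sublin0 sp).
  by apply: (q_ge) => t t0; rewrite add0r (sp.2 _ _ t0) subrr.
have qhom1 t x : 0 < t -> q (t *: x) <= t * q x.
  move=> t0; rewrite mulrC -ler_pdivrMr //; apply: (q_ge) => s s0.
  rewrite ler_pdivrMr //; apply: le_trans (qle _ (t * s) _) _.
    by rewrite mulr_ge0 // ltW.
  by rewrite -scalerA -scalerDr (sp.2 _ _ (ltW t0)); lra.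
have qhom t x : 0 <= t -> q (t *: x) = t * q x.
  rewrite le_eqVlt => /predU1P[<-|t0]; first by rewrite scale0r mul0r.
  apply/eqP; rewrite eq_le qhom1 //=.
  have := @qhom1 t^-1 (t *: x); rewrite invr_gt0 => /(_ t0).
  by rewrite scalerA mulVf ?gt_eqF // scale1r ler_pdivlMl.
have sq : sublin q by [].
(* The competitor t = 1 gives [q (- e) <= p 0 - p e]; together with [- q (- e) <= q e <= p e] this
   squeezes [q e] to [p e]. *)
have qNe : q (- e) <= - p e.
  have := qle (- e) 1 ler01; rewrite scale1r addNr (sublin0 sp) mul1r; lra.
have := sublin_ge_opp e sq; have := qp e => h1 h2.
by exists q; split=> //; rewrite /aligned; lra.
Qed.

(** The chain [p x = - p (- x) <= - q (- x) <= q x <= p x] collapses. Hence lowering a functional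
    further never spoils the directions already treated. *)
Lemma aligned_le p q x : sublin q -> (forall x, q x <= p x) ->
  aligned p x -> aligned q x /\ q x = p x.
Proof.
move=> sq qp; rewrite /aligned => px; have := qp x; have := qp (- x).
have := sublin_ge_opp x sq; rewrite px => h1 h2 h3; split; lra.
Qed.

Lemma sublin_align_seq (es : seq V) p : sublin p ->
  exists q, [/\ sublin q, (forall x, q x <= p x) &
                forall e, e \in es -> aligned q e].
Proof.
elim: es p => [|e es IH] p sp; first by exists p.
have [p1 [sp1 p1p al _]] := sublin_align e sp.
have [q [sq qp1 qal]] := IH _ sp1.
exists q; split => // [x|e']; first exact: le_trans (p1p x).
by rewrite inE => /predU1P[->|/qal//]; case: (aligned_le sq qp1 al).
Qed.

Lemma alignedD p x y : sublin p -> aligned p x -> aligned p y ->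
  aligned p (x + y) /\ p (x + y) = p x + p y.
Proof.
move=> sp; rewrite /aligned => px py.
have := sublin_ge_opp (x + y) sp; have := sp.1 x y; have := sp.1 (- x) (- y).
rewrite px py -opprD => h1 h2 h3; split; lra.
Qed.

Lemma alignedZ p x t : sublin p -> aligned p x ->
  aligned p (t *: x) /\ p (t *: x) = t * p x.
Proof.
move=> sp; rewrite /aligned => px.
have [t0|/ltW t0] := leP 0 t.
  by rewrite -scalerN !(sp.2 _ _ t0) px mulrN.
have t0' : 0 <= - t by rewrite oppr_ge0.
have E : p (t *: x) = t * p x.
  by rewrite -[t *: x]opprK -scaleNr -scalerN (sp.2 _ _ t0') px mulrNN.
by split=> //; rewrite E -scaleNr (sp.2 _ _ t0') mulNr.
Qed.

End Sublinear.

(** * Quadratic forms and linear minorants of a sublinear elliptic function *)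

Section Trace.
Context {R : realType} {n : nat}.
Implicit Types (A X : 'M[R]_n) (xi : 'rV[R]_n).

Lemma symmetricmxP X : reflect (X = X^T) (X \is symmetricmx).
Proof.
apply: (iffP (is_hermitianmxP _ _ _)); rewrite expr0 scale1r => {1}->;
  by apply/matrixP => i j; rewrite !mxE.
Qed.

Lemma qformE X xi : qform X xi = \sum_i \sum_j xi 0 i * X i j * xi 0 j.
Proof.
rewrite /qform mxE exchange_big /=; apply: eq_bigr => j _.
by rewrite !mxE mulr_suml.
Qed.

Lemma qformD X Y xi : qform (X + Y) xi = qform X xi + qform Y xi.
Proof. by rewrite /qform mulmxDr mulmxDl mxE. Qed.

Lemma qformZ (a : R) X xi : qform (a *: X) xi = a * qform X xi.
Proof. by rewrite /qform -scalemxAr -scalemxAl mxE. Qed.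

Lemma qformN X xi : qform (- X) xi = - qform X xi.
Proof. by rewrite -scaleN1r qformZ mulN1r. Qed.

Lemma qform_line A xi eta (t : R) : A \is symmetricmx ->
  qform A (xi + t *: eta) =
  qform A xi + 2 * t * (xi *m A *m eta^T) 0 0 + t ^+ 2 * qform A eta.
Proof.
move=> /symmetricmxP As; rewrite /qform linearD linearZ /= !mulmxDl !mulmxDr.
rewrite -!scalemxAl -!scalemxAr.
have -> : eta *m A *m xi^T = (xi *m A *m eta^T)^T by rewrite !trmx_mul trmxK -As mulmxA.
move: (xi *m A *m xi^T) (xi *m A *m eta^T) (eta *m A *m eta^T) => a b c.
rewrite !mxE; ring.
Qed.

Lemma qform_delta A i : qform A (delta_mx 0 i) = A i i.
Proof. by rewrite /qform -rowE trmx_delta -colE !mxE. Qed.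

Lemma mul_delta A xi i : (xi *m A *m (delta_mx 0 i : 'rV[R]_n)^T) 0 0 = (xi *m A) 0 i.
Proof. by rewrite trmx_delta -colE mxE. Qed.

(** On the sum of basis vector i and t times basis vector j the form is [2 * t * A i j], which must
    be nonnegative for both signs of t. *)
Lemma psd_diag0 A : A \is symmetricmx -> (forall xi, 0 <= qform A xi) ->
  (forall i, A i i = 0) -> A = 0.
Proof.
move=> As Ap Ad; apply/matrixP => i j; rewrite mxE.
have H t : 0 <= 2 * t * A i j.
  have := Ap (delta_mx 0 i + t *: delta_mx 0 j).
  by rewrite qform_line // !qform_delta !Ad mul_delta -rowE mxE; lra.
by have := H 1; have := H (-1); lra.
Qed.

(** Cholesky elimination, by induction on the number of nonzero diagonal entries: subtracting the
    square built from row k leaves the Schur complement, whose diagonal vanishes at k and wherever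
    that of [A] did. *)
Lemma psd_sum_of_squares A : A \is symmetricmx -> (forall xi, 0 <= qform A xi) ->
  exists bs : seq 'rV[R]_n, A = \sum_(b <- bs) b^T *m b.
Proof.
have [m] := ubnP #|[set i | A i i != 0]|%SET.
elim: m A => // m IH A; rewrite ltnS => Am As Ap.
have [k Ak|A0] := pickP (fun i => A i i != 0); last first.
  exists [::]; rewrite big_nil; apply: psd_diag0 => // i.
  by have /negbFE/eqP := A0 i.
have Akk : 0 < A k k by rewrite lt_def Ak -qform_delta Ap.
pose b := (Num.sqrt (A k k))^-1 *: row k A.
have sqr_s : (Num.sqrt (A k k))^-1 * (Num.sqrt (A k k))^-1 = (A k k)^-1.
  by rewrite -invfM -expr2 sqr_sqrtr // ltW.
have bb i j : (b^T *m b) i j = A k i * A k j / A k k.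
  rewrite !mxE big_ord1 !mxE mulrACA sqr_s mulrC; ring.
have qbb xi : qform (b^T *m b) xi = ((xi *m A) 0 k) ^+ 2 / A k k.
  have -> : (xi *m A) 0 k = \sum_j A k j * xi 0 j.
    by rewrite mxE; apply: eq_bigr => j _; rewrite mulrC {1}(symmetricmxP _ As) mxE.
  rewrite qformE expr2 mulr_suml mulr_suml; apply: eq_bigr => i _.
  rewrite mulr_sumr mulr_suml; apply: eq_bigr => j _; rewrite bb; ring.
have A's : A - b^T *m b \is symmetricmx.
  by apply/symmetricmxP; rewrite linearB /= trmx_mul trmxK -(symmetricmxP _ As).
have A'p xi : 0 <= qform (A - b^T *m b) xi.
  (* The Schur complement at [xi] is the minimum of the form of [A] on the line through [xi] in
     coordinate direction k; this is the minimizing shift. *)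
  have := Ap (xi + (- ((xi *m A) 0 k / A k k)) *: delta_mx 0 k).
  rewrite qform_line // qform_delta mul_delta qformD qformN qbb.
  congr (0 <= _); field; exact: lt0r_neq0.
have A'E i j : (A - b^T *m b) i j = A i j - A k i * A k j / A k k.
  by rewrite mxE [X in _ + X]mxE bb.
have [] := IH _ _ A's A'p.
  apply: leq_trans Am; apply/proper_card/properP; split.
    apply/fintype.subsetP => i; rewrite !inE; apply: contraNN => /eqP Ai.
    have := A'p (delta_mx 0 i); rewrite qform_delta A'E Ai.
    have -> : 0 - A k i * A k i / A k k = - (A k i ^+ 2 / A k k) by ring.
    rewrite oppr_ge0 => h; rewrite oppr_eq0; apply/eqP/le_anti; rewrite h /=.
    by rewrite divr_ge0 ?sqr_ge0 // ltW.
  exists k; rewrite !inE // negbK; apply/eqP.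
  rewrite A'E; field; exact: lt0r_neq0.
move=> bs E; exists (b :: bs).
by rewrite big_cons -E addrC subrK.
Qed.

Lemma aligned_matrix_sum (q : 'M[R]_n -> R) X : sublin q ->
  (forall i j, aligned q (delta_mx i j)) ->
  q X = \sum_i \sum_j X i j * q (delta_mx i j).
Proof.
move=> sq al.
have al0 : aligned q 0 by rewrite /aligned oppr0 (sublin0 sq) oppr0.
suff : aligned q X /\ q X = \sum_i \sum_j X i j * q (delta_mx i j) by case.
rewrite {1 2}[X]matrix_sum_delta.
pose K Y (r : R) := aligned q Y /\ q Y = r.
have KD Y1 r1 Y2 r2 : K Y1 r1 -> K Y2 r2 -> K (Y1 + Y2) (r1 + r2).
  by move=> [a1 <-] [a2 <-]; exact: alignedD.
have K0 : K 0 0 by split => //; exact: sublin0.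
apply: (big_ind2 K) => // i _; apply: (big_ind2 K) => // j _.
exact: alignedZ.
Qed.

(* The coefficients of a linear minorant of F form a positive semidefinite
   matrix, because F is nonpositive on negative semidefinite matrices. *)
Lemma elliptic_sublinear_support (F : 'M[R]_n -> R) (X0 : 'M[R]_n) :
  degenerate_elliptic F -> sublinear F -> X0 \is symmetricmx ->
  exists bs : seq 'rV[R]_n,
    (forall X, X \is symmetricmx -> \sum_(b <- bs) qform X b <= F X) /\
    \sum_(b <- bs) qform X0 b = F X0.
Proof.
move=> Fell [FD FZ] X0s.
(* [F] is controlled on symmetric matrices only; composed with symmetrization it becomes sublinear
   on all matrices. *)
pose symp X : 'M[R]_n := 2^-1 *: (X + X^T).
have symps X : symp X \is symmetricmx.
  by apply/symmetricmxP/matrixP => i j; rewrite !mxE addrC.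
have sympE X : X \is symmetricmx -> symp X = X.
  move=> /symmetricmxP Xs; rewrite /symp -Xs; apply/matrixP => i j.
  by rewrite !mxE; field.
have sympD X Y : symp (X + Y) = symp X + symp Y.
  by apply/matrixP => i j; rewrite !mxE; ring.
have sympZ t X : symp (t *: X) = t *: symp X.
  by apply/matrixP => i j; rewrite !mxE; ring.
have sF : sublin (F \o symp).
  split=> [X Y|t X t0] /=; first by rewrite sympD FD.
  by rewrite sympZ FZ.
have F0 : F 0 = 0.
  have /symmetricmxP s0 : (0 : 'M[R]_n) = 0^T by rewrite trmx0.
  by have := FZ 0 0 s0 (lexx _); rewrite scale0r mul0r.
(* [X0] is aligned before the basis matrices: this freezes the value there, so the final minorant
   touches [F] at [X0]. *)
have [p [sp pF alp pX0]] := sublin_align X0 sF.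
have [q [sq qp al]] :=
  sublin_align_seq [seq delta_mx ij.1 ij.2 | ij <- enum {: 'I_n * 'I_n}] sp.
have qF X : X \is symmetricmx -> q X <= F X.
  by move=> Xs; rewrite (le_trans (qp _)) // (le_trans (pF _)) //= sympE.
have ald i j : aligned q (delta_mx i j).
  by apply: al; apply/mapP; exists (i, j); rewrite ?mem_enum.
have qX0 : q X0 = F X0 by rewrite (aligned_le sq qp alp).2 pX0 /= sympE.
pose A := \matrix_(i, j) q (delta_mx i j).
have qE X : q X = \sum_i \sum_j X i j * A i j.
  rewrite (aligned_matrix_sum _ sq ald) //.
  by apply: eq_bigr => i _; apply: eq_bigr => j _; rewrite mxE.
(* [q] lies below [F \o symp], which vanishes on the difference of a basis matrix and its
   transpose. *)
have As : A \is symmetricmx.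
  have le i j : q (delta_mx i j) <= q (delta_mx j i).
    have [_] := alignedD sq (ald i j) (alignedZ (-1) sq (ald j i)).1.
    rewrite (alignedZ (-1) sq (ald j i)).2 => E.
    have := le_trans (qp _) (pF (delta_mx i j + -1 *: delta_mx j i)).
    rewrite E /= (_ : symp _ = 0) ?F0; first lra.
    apply/matrixP => k l; rewrite /symp !mxE.
    by rewrite [(l == i) && _]andbC [(l == j) && _]andbC; ring.
  by apply/symmetricmxP/matrixP => i j; rewrite !mxE; apply/le_anti; rewrite !le.
have Ap xi : 0 <= qform A xi.
  pose Z := xi^T *m xi.
  have Zs : - Z \is symmetricmx.
    by apply/symmetricmxP; rewrite linearN /= /Z trmx_mul trmxK.
  have -> : qform A xi = - q (- Z).
    rewrite qE qformE -sumrN; apply: eq_bigr => i _; rewrite -sumrN.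
    apply: eq_bigr => j _; rewrite [(- Z) i j]mxE [Z i j]mxE big_ord1 [_^T i 0]mxE.
    ring.
  rewrite oppr_ge0 (le_trans (qF _ Zs)) // -F0; apply: Fell => //.
    by apply/symmetricmxP; rewrite trmx0.
  move=> eta; have -> : qform 0 eta = 0 by rewrite /qform mulmx0 mul0mx mxE.
  rewrite qformN oppr_le0 /qform /Z mulmxA -mulmxA.
  have -> : xi *m eta^T = (eta *m xi^T)^T by rewrite trmx_mul trmxK.
  rewrite mxE big_ord1 [_^T 0 0]mxE.
  by rewrite -expr2 sqr_ge0.
have [bs E] := psd_sum_of_squares As Ap.
have qbs X : q X = \sum_(b <- bs) qform X b.
  rewrite qE E; under eq_bigr => i _.
    under eq_bigr => j _ do rewrite summxE mulr_sumr.
    rewrite exchange_big /=; over.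
  rewrite exchange_big /=; apply: eq_bigr => b _; rewrite qformE.
  apply: eq_bigr => i _; apply: eq_bigr => j _.
  by rewrite mxE big_ord1 [_^T i 0]mxE; ring.
by exists bs; split => [X Xs|]; rewrite -qbs // qF.
Qed.

End Trace.

(** * Compactness *)

(** Lebesgue's number lemma phrased for pairs of points; the halved radius leaves room for the
    second point. It yields uniform continuity, a uniform distance to the complement of an open set,
    and the comparison of two semicontinuous functions near the boundary. *)
Lemma compact_uniform {R : realType} {T : pseudoMetricType R} (K : set T)
    (Q : T -> T -> Prop) : compact K ->
  (forall z, K z -> exists2 r : R, 0 < r &
     forall x y, ball z r x -> ball z r y -> Q x y) ->
  exists2 r : R, 0 < r & forall x y, K x -> ball x r y -> Q x y.
Proof.
move=> /compact_near_coveringP cK locQ.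
have [|r /= r0 H] := cK R (0^'+) (fun r x => forall y, ball x r y -> Q x y) _.
  move=> z /locQ[r r0 Qr].
  exists (ball z (r / 2), [set s | 0 < s /\ s < r / 2]) => /=.
    split; first by apply: nbhsx_ballx; rewrite divr_gt0.
    near=> s; split; first by near: s; exact: nbhs_right_gt.
    by near: s; apply: nbhs_right_lt; rewrite divr_gt0.
  move=> [x s] /= [zx [s0 sr]] y xy; apply: Qr.
    by apply: le_ball zx; lra.
  rewrite [r]splitr; apply: ball_triangle zx _.
  by apply: le_ball xy; exact: ltW.
exists (r / 2); first by rewrite divr_gt0.
move=> x y Kx xy; apply: (H (r / 2)) => //=; last by rewrite divr_gt0.
rewrite sub0r normrN gtr0_norm ?divr_gt0 //; lra.
Unshelve. all: by end_near. Qed.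

(** Without a maximum the sets where [h] lies below some [h y] form a chain covering [K], and
    compactness would make one of them contain its own y. Any order type is allowed, so that real
    and extended real values are served alike. *)
Lemma compact_usc_max {T : topologicalType} {d : Order.disp_t} {O : orderType d}
    (K : set T) (h : T -> O) : compact K -> K !=set0 ->
  (forall x y, K x -> K y -> (h x < h y)%O ->
     \forall x' \near x, K x' -> (h x' < h y)%O) ->
  exists2 x, K x & forall y, K y -> (h y <= h x)%O.
Proof.
move=> /compact_near_coveringP/near_covering_withinP cK [y0 Ky0] usc.
apply: contrapT => nomax.
have gt x : K x -> exists2 y, K y & (h x < h y)%O.
  move=> Kx; apply: contrapT => H; apply: nomax; exists x => // y Ky.
  by rewrite leNgt; apply/negP => xy; apply: H; exists y.
pose B y := [set y' | K y' /\ (h y <= h y')%O].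
have FF : Filter (filter_from K B).
  apply: filter_from_filter; first by exists y0.
  move=> y1 y2 K1 K2; have [le12|/ltW le21] := leP (h y1) (h y2).
    by exists y2 => // y [Ky ?]; split; split=> //; exact: le_trans le12 _.
  by exists y1 => // y [Ky ?]; split; split=> //; exact: le_trans le21 _.
have [x Kx /(_ x)] : filter_from K B (fun y => K `<=` (fun x => (h x < h y)%O)).
  apply: (cK _ (filter_from K B) (fun y x => (h x < h y)%O) FF) => x Kx; have [y Ky xy] := gt _ Kx.
  exists ([set x' | K x' -> (h x' < h y)%O], B y) => /=.
    by split; [exact: usc | exists y].
  by move=> [x' y'] /= [x'y [Ky' yy']] Kx'; apply: lt_le_trans yy'; exact: x'y.
by move=> /(_ (conj Kx (lexx _)) x Kx); rewrite ltxx.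
Qed.

(** * One-dimensional averages *)

Section Average.
Context {R : realType}.
Implicit Types (g : R -> R) (d : R).
Notation mu := (@lebesgue_measure R).

Definition average d g : R :=
  (2 * d)^-1 * (\int[mu]_(s in `[- d, d]) g s)%R.

Lemma continuous_integrable_itv g (a b : R) : continuous g ->
  mu.-integrable `[a, b] (EFin \o g).
Proof.
move=> cg; apply: continuous_compact_integrable; first exact: segment_compact.
exact: continuous_subspaceT.
Qed.

Lemma averageD d g1 g2 : continuous g1 -> continuous g2 ->
  average d (fun s => g1 s + g2 s) = average d g1 + average d g2.
Proof.
move=> c1 c2; rewrite /average RintegralD ?mulrDr //;
  exact: continuous_integrable_itv.
Qed.

Lemma averageZ d a g : continuous g ->
  average d (fun s => a * g s) = a * average d g.
Proof.
by move=> cg; rewrite /average RintegralZl //; [rewrite mulrCA | exact: continuous_integrable_itv].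
Qed.

Lemma average_cst d a : 0 < d -> average d (fun=> a) = a.
Proof.
move=> d0; rewrite /average Rintegral_cst //= lebesgue_measure_itv /= lte_fin.
rewrite ifT; last by lra.
by rewrite -EFinB /=; field; rewrite gt_eqF.
Qed.

Lemma average_le d g1 g2 : 0 < d -> continuous g1 -> continuous g2 ->
  (forall s, `|s| <= d -> g1 s <= g2 s) -> average d g1 <= average d g2.
Proof.
move=> d0 c1 c2 le12; rewrite /average ler_pM2l ?invr_gt0 ?mulr_gt0 //.
apply: le_Rintegral => //; try exact: continuous_integrable_itv.
by move=> s /=; rewrite in_itv /= -ler_norml; exact: le12.
Qed.

(** Sliding the window changes the integral through its end values only, so continuity of [g]
    already gives a derivative. *)
Lemma average_shift_derive d g : 0 < d -> continuous g ->
  is_derive (0 : R) 1 (fun t => average d (fun s => g (s + t)))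
    ((2 * d)^-1 * (g d - g (- d))).
Proof.
move=> d0 cg.
(* A base point to the left of every window shifted by t > - 1, so that all these integrals are
   differences of one primitive [G]. *)
pose a := - d - 1.
pose G (y : R) : R := (\int[mu]_(s in `[a, y]) g s)%R.
have dG (y : R) : a < y -> is_derive y 1 G (g y).
  move=> ay.
  have [dr E] : derivable G y 1 /\ derive1 G y = g y.
    apply: (@continuous_FTC1_closed _ g a y (y + 1)) => //; last exact: cg.
      by rewrite ltrDl.
    exact: continuous_integrable_itv.
  by rewrite -E derive1E; exact: derivableP.
have dGs (t s : R) : - 1 < t -> - d <= s -> is_derive s 1 (fun s => G (s + t)) (g (s + t)).
  move=> t1 s1.
  have st : a < s + t by rewrite /a; lra.
  have h : is_derive s 1 (fun s : R => s + t) 1.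
    by have := is_deriveD (is_derive_id s 1) (is_derive_cst t s 1); rewrite addr0.
  have := @is_derive1_comp _ G (fun s => s + t) s (g (s + t)) 1 (dG _ st) h.
  by rewrite mulr1.
have E (t : R) : - 1 < t -> (\int[mu]_(s in `[- d, d]) g (s + t))%R = G (d + t) - G (- d + t).
  move=> t1; have cgt : continuous (fun s => g (s + t)).
    move=> s; apply: (@continuous_comp _ _ _ (fun s => s + t) g); last exact: cg.
    exact: cvgD cvg_id (cvg_cst _).
  rewrite /Rintegral (@continuous_FTC2 _ (fun s => g (s + t)) (fun s => G (s + t))) //.
  - lra.
  - exact: continuous_subspaceT.
  - have cG (s : R) : - d <= s -> {for s, continuous (fun s : R => G (s + t))}.
      move=> sd; apply/differentiable_continuous/derivable1_diffP.
      exact: (@ex_derive _ _ _ _ _ _ _ (dGs _ _ t1 sd)).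
    split.
    + move=> s; rewrite in_itv /= => /andP[/ltW s1 _].
      exact: (@ex_derive _ _ _ _ _ _ _ (dGs _ _ t1 s1)).
    + by apply: cvg_at_right_filter; apply: cG.
    + by apply: cvg_at_left_filter; apply: cG; lra.
  - move=> s; rewrite in_itv /= => /andP[/ltW s1 _].
    by rewrite derive1E; apply: (@derive_val _ _ _ _ _ _ _ (dGs _ _ t1 s1)).
have cG (c : R) : - d <= c -> is_derive (0 : R) 1 (fun t : R => G (c + t)) (g c).
  move=> dc.
  have h : is_derive (0 : R) 1 (fun t : R => c + t) 1.
    by have := is_deriveD (is_derive_cst c (0 : R) 1) (is_derive_id (0 : R) 1); rewrite add0r.
  have ac : a < c + 0 by rewrite /a; lra.
  have := @is_derive1_comp _ G (fun t => c + t) 0 (g (c + 0)) 1 (dG _ ac) h.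
  by rewrite mulr1 addr0.
have hd : - d <= d by lra.
have D : is_derive (0 : R) 1 (fun t : R => (2 * d)^-1 * (G (d + t) - G (- d + t)))
    ((2 * d)^-1 * (g d - g (- d))).
  exact: (is_deriveZ (2 * d)^-1 (is_deriveB (cG _ hd) (cG _ (lexx _)))).
suff N : \forall t \near (0 : R), (2 * d)^-1 * (G (d + t) - G (- d + t)) =
    average d (fun s : R => g (s + t)).
  exact: near_eq_is_derive N D.
near=> t; rewrite /average E //.
near: t; apply: lt_nbhsr; lra.
Unshelve. all: by end_near. Qed.

End Average.

(** * Continuity and derivatives along lines, in epsilon form *)

Lemma continuous_distP {R : realType} {V : normedModType R} (f : V -> R) :
  continuous f <-> forall x (e : R), 0 < e ->
    exists2 r : R, 0 < r & forall y, `|y - x| < r -> `|f y - f x| <= e.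
Proof.
split=> [cf x e e0|H x].
  have /cvgrPdist_le/(_ _ e0)/nbhs_ballP[r /= r0 Hr] := cf x.
  exists r => // y yx; rewrite distrC; apply: Hr.
  by rewrite -ball_normE /= distrC.
apply/(@cvgrPdist_le _ _ _ (nbhs x)) => e /(H x)[r r0 Hr].
apply/nbhs_ballP; exists r => // y; rewrite -ball_normE /= distrC => /Hr.
by rewrite distrC.
Qed.

Lemma continuous_uniform_near_compact {R : realType} {V : normedModType R}
    (K : set V) (f : V -> R) : compact K -> continuous f ->
  forall e : R, 0 < e -> exists2 r : R, 0 < r &
    forall x y, K x -> `|y - x| < r -> `|f y - f x| <= e.
Proof.
move=> cK /continuous_distP cf e e0.
have [|r r0 Hr] := @compact_uniform _ _ K (fun x y => `|f y - f x| <= e) cK.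
  move=> z _; have [|r r0 H] := cf z (e / 2); first by rewrite divr_gt0.
  exists r => // x y; rewrite -ball_normE /= distrC => /H xz.
  rewrite distrC => /H yz; rewrite [e]splitr -[f y - f x](subrKA (f z)).
  by apply: le_trans (ler_normD _ _) _; rewrite lerD // distrC.
by exists r => // x y Kx yx; apply: Hr; rewrite // -ball_normE /= distrC.
Qed.

Lemma compact_continuous_max {R : realType} {T : topologicalType} (K : set T)
    (f : T -> R) : compact K -> K !=set0 -> continuous f ->
  exists2 x, K x & forall y, K y -> f y <= f x.
Proof.
move=> cK K0 cf; apply: compact_usc_max => // y z _ _ yz.
near=> y' => _; near: y'; exact: (cf y) _ (lt_nbhsl yz).
Unshelve. all: by end_near. Qed.

Section ContinuousOps.
Context {R : realType} {V : normedModType R}.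
Implicit Types f g : V -> R.

Lemma continuous_add f g : continuous f -> continuous g ->
  continuous (fun x => f x + g x).
Proof. by move=> cf cg x; apply: cvgD; [exact: cf|exact: cg]. Qed.

Lemma continuous_mul f g : continuous f -> continuous g ->
  continuous (fun x => f x * g x).
Proof. by move=> cf cg x; apply: cvgM; [exact: cf|exact: cg]. Qed.

Lemma continuous_scale (a : R) f : continuous f -> continuous (fun x => a * f x).
Proof. by move=> cf x; apply: cvgM; [exact: cvg_cst|exact: cf]. Qed.

Lemma continuous_shift z f : continuous f -> continuous (fun x => f (x + z)).
Proof.
move=> cf x; apply: (@continuous_comp _ _ _ (fun x => x + z) f _ _ (cf _)).
by apply: cvgD; [exact: cvg_id|exact: cvg_cst].
Qed.

Lemma sub_continuous (x : V) : continuous (fun y => x - y).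
Proof. by move=> y; apply: cvgB; [exact: cvg_cst|exact: cvg_id]. Qed.

Lemma continuous_reflect x f : continuous f -> continuous (fun y => f (x - y)).
Proof.
move=> cf y; apply: (@continuous_comp _ _ _ (fun y => x - y) f _ _ (cf _)).
exact: sub_continuous.
Qed.

End ContinuousOps.
Arguments continuous_scale {R V} a {f}.
Arguments continuous_shift {R V} z {f}.
Arguments continuous_reflect {R V} x {f}.

Lemma is_deriveP {R : realType} {V : normedModType R} (f : V -> R) x v (a : R) :
  is_derive x v f a <->
  forall e : R, 0 < e -> exists2 r : R, 0 < r &
    forall t, `|t| < r -> `|f (x + t *: v) - f x - t * a| <= e * `|t|.
Proof.
have E t : t != 0 ->
    `|a - t^-1 *: (f (t *: v + x) - f x)| = `|f (x + t *: v) - f x - t * a| / `|t|.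
  move=> t0; rewrite -normfV -normrM [t *: v + x]addrC distrC; congr `|_|.
  by rewrite /GRing.scale /=; field.
split=> [[dv dE] e e0|H].
  have cv : (fun h => h^-1 *: ((f \o shift x) (h *: v) - f x)) @ 0^' --> a.
    by rewrite -dE; exact: dv.
  have /cvgrPdist_le/(_ _ e0) := cv.
  rewrite near_withinE => -[r /= r0 Hr]; exists r => // t tr.
  have [->|t0] := eqVneq t 0.
    by rewrite scale0r addr0 subrr mul0r subrr normr0 mulr0.
  rewrite -ler_pdivrMr ?normr_gt0 // -E //.
  by apply: Hr => //=; rewrite sub0r normrN.
have cv : (fun h => h^-1 *: ((f \o shift x) (h *: v) - f x)) @ 0^' --> a.
  apply/cvgrPdist_le => e /H[r r0 Hr]; rewrite near_withinE; exists r => // t /=.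
  rewrite sub0r normrN => tr t0.
  by rewrite E // ler_pdivrMr ?normr_gt0 //; exact: Hr.
have dv : derivable f x v by apply/cvg_ex; exists a.
by apply: DeriveDef => //; apply: cvg_lim.
Qed.

Lemma is_derive_line {R : realType} {V : normedModType R} (f : V -> R) x v (a : R) :
  is_derive x v f a <-> is_derive (0 : R) 1 (fun t => f (x + t *: v)) a.
Proof.
split=> /is_deriveP H; apply/is_deriveP => e /H[r r0 Hr]; exists r => // t /Hr;
  by rewrite scale0r addr0 add0r [t *: 1]mulr1.
Qed.

Section LineDerivatives.
Context {R : realType} {V : normedModType R}.
Implicit Types (f g : V -> R) (x v : V).

Lemma continuous_line f x v : continuous f ->
  continuous (fun t : R => f (x + t *: v)).
Proof.
move=> cf t; apply: (@continuous_comp _ _ _ (fun t : R => x + t *: v) f _ _ (cf _)).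
by apply: cvgD; [exact: cvg_cst | exact: cvgZl].
Qed.

Lemma is_derive_line_at f v (g : V -> R) : (forall x, is_derive x v f (g x)) ->
  forall x (t : R), is_derive t 1 (fun t => f (x + t *: v)) (g (x + t *: v)).
Proof.
move=> fg x t; have /is_derive_line := fg (x + t *: v).
have -> : (fun s : R => f (x + t *: v + s *: v)) =
    (fun s : R => (fun t : R => f (x + t *: v)) (t + s *: 1)).
  by apply/funext => s; rewrite -addrA -scalerDl [s *: 1]mulr1.
by move=> /(is_derive_line (fun t : R => f (x + t *: v)) t 1).
Qed.

Lemma line_MVT f v (g : V -> R) : (forall x, is_derive x v f (g x)) ->
  forall x (t : R), exists2 s, `|s| <= `|t| & f (x + t *: v) - f x = t * g (x + s *: v).
Proof.
move=> fg x t; have dl := is_derive_line_at fg x.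
have cl : continuous (fun t : R => f (x + t *: v)).
  move=> s; apply/differentiable_continuous/derivable1_diffP.
  exact: (@ex_derive _ _ _ _ _ _ _ (dl s)).
have [t0|/ltW t0] := leP 0 t.
  have [s] := MVT_segment t0 (fun s _ => dl s) (continuous_subspaceT cl).
  rewrite in_itv /= => /andP[s0 st]; rewrite scale0r addr0 subr0 mulrC => E.
  by exists s => //; rewrite !ger0_norm.
have [s] := MVT_segment t0 (fun s _ => dl s) (continuous_subspaceT cl).
rewrite in_itv /= => /andP[ts s0]; rewrite scale0r addr0 sub0r => E.
exists s; first by rewrite !ler0_norm // lerN2.
by rewrite -opprB E mulrN opprK mulrC.
Qed.

End LineDerivatives.

(** * Mollification one coordinate at a time *)

Section Mollify.
Context {R : realType} {n : nat}.
Implicit Types (f g : 'rV[R]_n -> R) (x y z v : 'rV[R]_n) (i j : 'I_n) (d : R).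

Definition mollify1 d i f x : R := average d (fun s => f (x + s *: delta_mx 0 i)).

Lemma mollify1D d i f g x : continuous f -> continuous g ->
  mollify1 d i (fun y => f y + g y) x = mollify1 d i f x + mollify1 d i g x.
Proof. by move=> cf cg; apply: averageD; exact: continuous_line. Qed.

Lemma mollify1Z d i (a : R) f x : continuous f ->
  mollify1 d i (fun y => a * f y) x = a * mollify1 d i f x.
Proof. by move=> cf; apply: averageZ; exact: continuous_line. Qed.

Lemma mollify1_cst d i (a : R) x : 0 < d -> mollify1 d i (fun=> a) x = a.
Proof. exact: average_cst. Qed.

Lemma mollify1_shift d i f z x :
  mollify1 d i (fun y => f (y + z)) x = mollify1 d i f (x + z).
Proof. by rewrite /mollify1; congr average; apply/funext => s; rewrite addrAC. Qed.

Lemma mollify1_le d i f g x : 0 < d -> continuous f -> continuous g ->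
  (forall s, `|s| <= d -> f (x + s *: delta_mx 0 i) <= g (x + s *: delta_mx 0 i)) ->
  mollify1 d i f x <= mollify1 d i g x.
Proof. by move=> d0 cf cg; apply: average_le => //; exact: continuous_line. Qed.

Lemma mollify1_near d i f x (a e : R) : 0 < d -> continuous f ->
  (forall s, `|s| <= d -> `|f (x + s *: delta_mx 0 i) - a| <= e) ->
  `|mollify1 d i f x - a| <= e.
Proof.
move=> d0 cf H; rewrite ler_distl; apply/andP; split.
  rewrite -[leLHS](mollify1_cst i _ x d0); apply: mollify1_le => //.
    exact: cst_continuous.
  by move=> s /H; rewrite ler_distl => /andP[].
rewrite -[leRHS](mollify1_cst i _ x d0); apply: mollify1_le => //.
  exact: cst_continuous.
by move=> s /H; rewrite ler_distl => /andP[].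
Qed.

Lemma segment_uniform d i f x : continuous f -> forall e : R, 0 < e ->
  exists2 r : R, 0 < r & forall s y, `|s| <= d -> `|y| < r ->
    `|f (x + s *: delta_mx 0 i + y) - f (x + s *: delta_mx 0 i)| <= e.
Proof.
move=> cf e e0.
pose K := (fun s : R => x + s *: delta_mx 0 i : 'rV[R]_n) @` `[- d, d].
have cK : compact K.
  apply: continuous_compact; last exact: segment_compact.
  apply: continuous_subspaceT => t.
  by apply: cvgD; [exact: cvg_cst | exact: cvgZl].
have [r r0 H] := continuous_uniform_near_compact cK cf e0.
exists r => // s y sd yr; apply: H; last by rewrite addrAC subrr add0r.
by exists s => //=; rewrite in_itv /= -ler_norml.
Qed.

Lemma mollify1_continuous d i f : 0 < d -> continuous f -> continuous (mollify1 d i f).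
Proof.
move=> d0 cf; apply/continuous_distP => x e e0.
have [r r0 H] := segment_uniform d i x cf e0.
exists r => // y yx.
have cfy := continuous_shift (y - x) cf; have cNf := continuous_scale (-1) cf.
have -> : mollify1 d i f y = mollify1 d i (fun z => f (z + (y - x))) x.
  by rewrite mollify1_shift subrKC.
rewrite -mulN1r -mollify1Z // -mollify1D //.
rewrite -[X in `|X|]subr0; apply: mollify1_near => //; first exact: continuous_add.
by move=> s sd; rewrite subr0 mulN1r; exact: H.
Qed.

Definition diffq d i f x : R :=
  (2 * d)^-1 * (f (x + d *: delta_mx 0 i) - f (x - d *: delta_mx 0 i)).

(** The source of all smoothness of mollified functions: averaging in coordinate i trades the
    derivative in that coordinate for a difference quotient. *)
Lemma mollify1_derive_diffq d i f x : 0 < d -> continuous f ->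
  is_derive x (delta_mx 0 i) (mollify1 d i f) (diffq d i f x).
Proof.
move=> d0 cf; apply/is_derive_line.
have := average_shift_derive d0 (@continuous_line _ _ f x (delta_mx 0 i) cf).
rewrite /diffq scaleNr; under eq_fun => t.
  rewrite (_ : average _ _ = mollify1 d i f (x + t *: delta_mx 0 i)); last first.
    by congr average; apply/funext => s; rewrite scalerDl addrA addrAC.
  over.
by [].
Qed.

(** Differentiation under the average: by the mean value theorem the error at each point of the
    segment is governed by an increment of [g], small uniformly along the compact segment. *)
Lemma mollify1_derive d i f v g : 0 < d -> continuous f -> continuous g ->
  (forall x, is_derive x v f (g x)) ->
  forall x, is_derive x v (mollify1 d i f) (mollify1 d i g x).
Proof.
move=> d0 cf cg fg x; apply/is_deriveP => e e0.
have [r r0 H] := segment_uniform d i x cg e0.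
exists (r / (1 + `|v|)); first by rewrite divr_gt0 // ltr_wpDr.
move=> t; rewrite ltr_pdivlMr ?ltr_wpDr // => tr.
have cft := continuous_shift (t *: v) cf; have cNf := continuous_scale (-1) cf.
have cNg := continuous_scale (- t) cg; have cD := continuous_add cft cNf.
rewrite -mollify1_shift -mulN1r -mulNr -!mollify1Z // -!mollify1D //.
rewrite -[X in `|X|]subr0; apply: mollify1_near => //; first exact: continuous_add.
move=> s sd; rewrite subr0 mulN1r mulNr.
have [s' s't ->] := line_MVT fg (x + s *: delta_mx 0 i) t.
rewrite -mulrBr normrM mulrC ler_wpM2r //; apply: H => //.
rewrite normrZ; apply: le_lt_trans tr; apply: ler_pM => //.
by rewrite lerDr.
Qed.

End Mollify.

(** Ensures that both orders of differentiation consume the same averages, whence a symmetric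
    Hessian. *)
Lemma remAC {T : eqType} (x y : T) (s : seq T) : rem x (rem y s) = rem y (rem x s).
Proof.
elim: s => //= a s IH; have [->|ay] := eqVneq a y.
  by have [->//|ax] := eqVneq y x; rewrite /= eqxx.
by have [->|ax] := eqVneq a x; rewrite /= ?eqxx ?(negPf ay) ?(negPf ax) ?IH // eqxx.
Qed.

Section IteratedMollify.
Context {R : realType} {n : nat}.
Implicit Types (f g : 'rV[R]_n -> R) (x y z v : 'rV[R]_n) (i j : 'I_n) (d : R).
Implicit Types (l : seq 'I_n).

(** The list [l] records, with repetitions, the coordinates averaged over; a derivative in a
    coordinate consumes one occurrence of it. *)
Definition mollify d l f : 'rV[R]_n -> R := foldr (mollify1 d) f l.

Variable d : R.
Hypothesis d0 : 0 < d.

Lemma mollify_continuous l f : continuous f -> continuous (mollify d l f).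
Proof. by move=> cf; elim: l => //= i l; exact: mollify1_continuous. Qed.

Lemma mollifyD l f g : continuous f -> continuous g ->
  mollify d l (fun y => f y + g y) = fun x => mollify d l f x + mollify d l g x.
Proof.
move=> cf cg; elim: l => //= i l ->; apply/funext => x.
by apply: mollify1D; exact: mollify_continuous.
Qed.

Lemma mollifyZ l (a : R) f : continuous f ->
  mollify d l (fun y => a * f y) = fun x => a * mollify d l f x.
Proof.
move=> cf; elim: l => //= i l ->; apply/funext => x.
by apply: mollify1Z; exact: mollify_continuous.
Qed.

Lemma mollify_cst l (a : R) : mollify d l (fun=> a) = fun=> a.
Proof. by elim: l => //= i l ->; apply/funext => x; exact: mollify1_cst. Qed.

Lemma mollify_shift l f z :
  mollify d l (fun y => f (y + z)) = fun x => mollify d l f (x + z).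
Proof. by elim: l => //= i l ->; apply/funext => x; exact: mollify1_shift. Qed.

Lemma normr_scale_delta (s : R) i : `|s *: delta_mx 0 i : 'rV[R]_n| <= `|s|.
Proof.
rewrite normrZ -[leRHS]mulr1 ler_wpM2l // [leLHS]/Num.norm /= mx_normrE.
apply/bigmax_leP; split => // -[k j] _ /=; rewrite mxE.
by case: (_ && _); rewrite ?normr1 ?normr0.
Qed.

(** Each average moves the point by at most [d] in the supremum norm, so the value at [x] depends
    only on a ball of radius [d] times the length of [l]. *)
Lemma mollify_le l f g x : continuous f -> continuous g ->
  (forall y, `|y - x| <= d *+ size l -> f y <= g y) ->
  mollify d l f x <= mollify d l g x.
Proof.
move=> cf cg; elim: l x => /= [|i l IH] x H.
  by apply: H; rewrite subrr normr0.
apply: mollify1_le => //; try exact: mollify_continuous.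
move=> s sd; apply: IH => y yx; apply: H.
rewrite -(subrKA (x + s *: delta_mx 0 i)) addrC mulrS addrC.
apply: le_trans (ler_normD _ _) _; rewrite addrC lerD //.
by rewrite addrAC subrr add0r; exact: le_trans (normr_scale_delta _ _) sd.
Qed.

Lemma mollify_near l f x (a e : R) : continuous f ->
  (forall y, `|y - x| <= d *+ size l -> `|f y - a| <= e) ->
  `|mollify d l f x - a| <= e.
Proof.
move=> cf H; rewrite ler_distl; apply/andP; split.
  have -> : a - e = mollify d l (fun=> a - e) x by rewrite mollify_cst.
  apply: mollify_le => //; first exact: cst_continuous.
  by move=> y /H; rewrite ler_distl => /andP[].
have -> : a + e = mollify d l (fun=> a + e) x by rewrite mollify_cst.
apply: mollify_le => //; first exact: cst_continuous.
by move=> y /H; rewrite ler_distl => /andP[].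
Qed.

Lemma diffq_continuous i f : continuous f -> continuous (diffq d i f).
Proof.
move=> cf; apply: continuous_scale.
have c1 := continuous_shift (d *: delta_mx 0 i) cf.
have c2 := continuous_scale (-1) (continuous_shift (- (d *: delta_mx 0 i)) cf).
by have := continuous_add c1 c2; under eq_fun do rewrite mulN1r.
Qed.

Lemma mollify_diffq l i f : continuous f ->
  mollify d l (diffq d i f) = diffq d i (mollify d l f).
Proof.
move=> cf; have c1 := continuous_shift (d *: delta_mx 0 i) cf.
have c2 := continuous_shift (- (d *: delta_mx 0 i)) cf.
have c3 := continuous_scale (-1) c2.
rewrite /diffq; under eq_fun do rewrite -mulN1r.
rewrite mollifyZ; last exact: continuous_add.
rewrite mollifyD // mollifyZ // !mollify_shift.
by under eq_fun do rewrite mulN1r.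
Qed.

Lemma diffqC i j f : diffq d i (diffq d j f) = diffq d j (diffq d i f).
Proof.
apply/funext => x; rewrite /diffq.
move: (d *: delta_mx 0 i) (d *: delta_mx 0 j) => a b.
by rewrite ![_ + _ + b]addrAC ![_ + _ - b]addrAC; ring.
Qed.

(** At the first occurrence of [j] the average turns into a difference quotient, which commutes with
    the inner averages; the outer ones, in other coordinates, are differentiated under the
    integral. *)
Lemma mollify_derive l f j : continuous f -> j \in l ->
  forall x, is_derive x (delta_mx 0 j) (mollify d l f)
                      (mollify d (rem j l) (diffq d j f) x).
Proof.
move=> cf; elim: l => //= i l IH; rewrite inE eq_sym.
have [->|ij] /= := eqVneq i j => [_|/IH dl] x.
  by rewrite mollify_diffq //; apply: mollify1_derive_diffq => //; exact: mollify_continuous.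
by apply: mollify1_derive => //; apply: mollify_continuous => //; exact: diffq_continuous.
Qed.

Lemma mollify_modulus l f (r e : R) : continuous f ->
  (forall x y, `|x - y| < r -> `|f x - f y| <= e) ->
  forall x y, `|x - y| < r -> `|mollify d l f x - mollify d l f y| <= e.
Proof.
move=> cf H x y xy.
have -> : mollify d l f x = mollify d l (fun z => f (z + (x - y))) y.
  by rewrite mollify_shift subrKC.
have cx := continuous_shift (x - y) cf; have cN := continuous_scale (-1) cf.
have -> : mollify d l (fun z => f (z + (x - y))) y - mollify d l f y =
  mollify d l (fun z => f (z + (x - y)) + -1 * f z) y - 0.
  by rewrite mollifyD // mollifyZ // subr0 mulN1r.
apply: mollify_near => //; first exact: continuous_add.
by move=> z _; rewrite subr0 mulN1r; apply: H; rewrite addrAC subrr add0r.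
Qed.

End IteratedMollify.

(** * Functions with continuous second derivatives *)

Section HasHessian.
Context {R : realType} {n : nat}.
Implicit Types (f g : 'rV[R]_n -> R) (x y z v b : 'rV[R]_n) (i j : 'I_n).
Implicit Types (H : 'rV[R]_n -> 'M[R]_n).

(** The hidden [g] is the gradient. Recording [is_derive] facts, instead of values of [partial],
    makes the class visibly closed under sums, translates and averages. *)
Definition has_hessian f H : Prop :=
  exists2 g : 'I_n -> 'rV[R]_n -> R,
    [/\ continuous f, forall i, continuous (g i) &
        forall i j, continuous (fun x => H x i j)] &
    (forall i x, is_derive x (delta_mx 0 i) f (g i x)) /\
    (forall i j x, is_derive x (delta_mx 0 i) (g j) (H x i j)).

Lemma has_hessian_continuous f H : has_hessian f H -> continuous f.
Proof. by case=> g []. Qed.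

Lemma has_hessian_C2 f H : has_hessian f H ->
  Ck_on 2 setT f /\ forall x, hessian f x = H x.
Proof.
move=> [g [cf cg cH] [df dg]].
have Ef i : partial i f = g i.
  by apply/funext => x; rewrite /partial; apply: (@derive_val _ _ _ _ _ _ _ (df i x)).
have Eg i j : partial i (g j) = (fun x => H x i j).
  by apply/funext => x; rewrite /partial; apply: (@derive_val _ _ _ _ _ _ _ (dg i j x)).
split; last by move=> x; apply/matrixP => i j; rewrite mxE Ef Eg.
split=> [x _|i]; first exact: cf.
split=> [x _|]; first exact: (@ex_derive _ _ _ _ _ _ _ (df i x)).
rewrite Ef; split=> [x _|j]; first exact: cg.
split=> [x _|]; first exact: (@ex_derive _ _ _ _ _ _ _ (dg j i x)).
by rewrite Eg; split => // x _; exact: cH.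
Qed.

Lemma has_hessian_cst (a : R) : has_hessian (fun=> a) (fun=> 0).
Proof.
exists (fun _ _ => 0); split; try move=> *; try exact: cst_continuous.
- exact: is_derive_cst.
- by rewrite mxE; exact: is_derive_cst.
Qed.

Lemma has_hessianD f1 H1 f2 H2 : has_hessian f1 H1 -> has_hessian f2 H2 ->
  has_hessian (fun x => f1 x + f2 x) (fun x => H1 x + H2 x).
Proof.
move=> [g1 [cf1 cg1 cH1] [df1 dg1]] [g2 [cf2 cg2 cH2] [df2 dg2]].
exists (fun i x => g1 i x + g2 i x); split => *.
- exact: continuous_add.
- exact: continuous_add.
- by under eq_fun do rewrite mxE; exact: continuous_add.
- exact: is_deriveD.
- by rewrite mxE; exact: is_deriveD.
Qed.

Lemma has_hessianZ (a : R) f H : has_hessian f H ->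
  has_hessian (fun x => a * f x) (fun x => a *: H x).
Proof.
move=> [g [cf cg cH] [df dg]]; exists (fun i x => a * g i x); split => *.
- exact: continuous_scale.
- exact: continuous_scale.
- by under eq_fun do rewrite mxE; exact: continuous_scale.
- exact: is_deriveZ.
- by rewrite mxE; exact: is_deriveZ.
Qed.

Lemma is_derive_shift f z x v (a : R) : is_derive (x + z) v f a ->
  is_derive x v (fun y => f (y + z)) a.
Proof.
move/is_derive_line => h; apply/is_derive_line.
by under eq_fun do rewrite addrAC.
Qed.

Lemma has_hessian_shift z f H : has_hessian f H ->
  has_hessian (fun x => f (x + z)) (fun x => H (x + z)).
Proof.
move=> [g [cf cg cH] [df dg]]; exists (fun i x => g i (x + z)); split => *.
- exact: continuous_shift.
- exact: continuous_shift.
- exact: (continuous_shift z (cH _ _)).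
- exact: is_derive_shift.
- exact: is_derive_shift.
Qed.

Lemma continuous_bigsum {I : Type} (r : seq I) (F : I -> 'rV[R]_n -> R) :
  (forall k, continuous (F k)) -> continuous (fun x => \sum_(k <- r) F k x).
Proof.
move=> cF; elim: r => [|k s IH].
  rewrite (_ : (fun _ => _) = fun=> 0); first exact: cst_continuous.
  by apply/funext => x; rewrite big_nil.
rewrite (_ : (fun _ => _) = fun x => F k x + \sum_(l <- s) F l x).
  exact: continuous_add.
by apply/funext => x; rewrite big_cons.
Qed.

Lemma mulmx_coord_continuous (A : 'M[R]_n) i :
  continuous (fun x : 'rV[R]_n => (x *m A) 0 i).
Proof.
rewrite (_ : (fun _ => _) = fun x => \sum_j A j i * x 0 j); last first.
  by apply/funext => x; rewrite mxE; apply: eq_bigr => j _; rewrite mulrC.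
apply: continuous_bigsum => j; apply: continuous_scale; exact: coord_continuous.
Qed.

Lemma qform_continuous (A : 'M[R]_n) : continuous (qform A).
Proof.
rewrite (_ : qform A = fun x => \sum_j (x *m A) 0 j * x 0 j); last first.
  by apply/funext => x; rewrite /qform mxE; apply: eq_bigr => j _; rewrite [_^T _ _]mxE.
apply: continuous_bigsum => j.
by apply: continuous_mul; [exact: mulmx_coord_continuous|exact: coord_continuous].
Qed.

Lemma has_hessian_qform (A : 'M[R]_n) : A \is symmetricmx ->
  has_hessian (qform A) (fun=> 2 *: A).
Proof.
move=> As; exists (fun i x => 2 * (x *m A) 0 i); split.
- exact: qform_continuous.
- by move=> i; apply: continuous_scale; exact: mulmx_coord_continuous.
- by move=> i j; exact: cst_continuous.
- move=> i x; apply/is_deriveP => e e0; exists (e / (1 + `|A i i|)).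
    by rewrite divr_gt0 // ltr_wpDr.
  move=> t; rewrite ltr_pdivlMr ?ltr_wpDr // => te.
  rewrite qform_line // qform_delta mul_delta.
  have -> : qform A x + 2 * t * (x *m A) 0 i + t ^+ 2 * A i i - qform A x -
    t * (2 * (x *m A) 0 i) = t * A i i * t by ring.
  rewrite !normrM ler_wpM2r //; apply: le_trans (ltW te).
  by rewrite ler_wpM2l // lerDr.
- move=> i j x; apply/is_deriveP => e e0; exists 1 => // t _.
  rewrite mulmxDl -scalemxAl -rowE !mxE.
  rewrite [X in `|X|](_ : _ = 0); first by rewrite normr0 mulr_ge0 // ltW.
  ring.
Qed.

Lemma has_hessian_mollify d l f : 0 < d -> continuous f ->
  (forall i j, i \in rem j l) ->
  has_hessian (mollify d l f)
    (fun x => \matrix_(i, j) mollify d (rem i (rem j l)) (diffq d i (diffq d j f)) x).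
Proof.
move=> d0 cf il; have cd i g : continuous g -> continuous (diffq d i g).
  by move=> cg; exact: diffq_continuous.
have ill i : i \in l by exact: mem_rem (il i i).
exists (fun j => mollify d (rem j l) (diffq d j f)); split.
- exact: mollify_continuous.
- by move=> i; apply: mollify_continuous => //; exact: cd.
- move=> i j; rewrite (_ : (fun _ => _) =
    mollify d (rem i (rem j l)) (diffq d i (diffq d j f))).
    by apply: mollify_continuous => //; exact: (cd _ _ (cd _ _ cf)).
  by apply/funext => x; rewrite mxE.
- by move=> i x; exact: mollify_derive.
- by move=> i j x; rewrite mxE; apply: mollify_derive => //; exact: cd.
Qed.

(** The increment splits into a leg along [v] and a leg along [w]. The second leg starts at a moving
    point, so it is treated by the mean value theorem and continuity of [g2]. *)
Lemma is_derive_combination f g1 g2 v w (c : R) :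
  (forall x, is_derive x v f (g1 x)) -> (forall x, is_derive x w f (g2 x)) ->
  continuous g2 -> forall x, is_derive x (v + c *: w) f (g1 x + c * g2 x).
Proof.
move=> d1 d2 /continuous_distP c2 x; apply/is_deriveP => e e0.
have e2 : 0 < e / 2 by rewrite divr_gt0.
have ec : 0 < e / 2 / (1 + `|c|) by rewrite divr_gt0 // ltr_wpDr.
have /is_deriveP/(_ _ e2)[r1 r10 H1] := d1 x.
have [r2 r20 H2] := c2 x _ ec.
pose N := `|v| + `|c| * `|w| + 1.
have N0 : 0 < N by rewrite /N ltr_wpDl // addr_ge0 // mulr_ge0.
exists (Num.min r1 (r2 / N)); first by rewrite lt_min r10 divr_gt0.
move=> t; rewrite lt_min => /andP[/H1 t1]; rewrite ltr_pdivlMr // => tN.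
have [s st E] := line_MVT d2 (x + t *: v) (t * c).
have -> : f (x + t *: (v + c *: w)) - f x - t * (g1 x + c * g2 x) =
    (f (x + t *: v) - f x - t * g1 x) +
    t * c * (g2 (x + t *: v + s *: w) - g2 x).
  by rewrite mulrBr -E scalerDr scalerA addrA; ring.
rewrite [e]splitr mulrDl; apply: le_trans (ler_normD _ _) _; rewrite lerD //.
rewrite !normrM -mulrA mulrC ler_wpM2r //.
have /H2 : `|x + t *: v + s *: w - x| < r2.
  rewrite -[x + _ + _]addrA addrAC subrr add0r; apply: le_lt_trans tN.
  apply: le_trans (ler_normD _ _) _; rewrite !normrZ /N !mulrDr mulr1.
  rewrite -[leLHS]addr0 lerD // lerD // mulrA ler_wpM2r //.
  by rewrite -normrM.
rewrite ler_pdivlMr ?ltr_wpDr // => h; apply: le_trans h.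
by rewrite mulrC ler_wpM2l // lerDr.
Qed.

Lemma is_derive_direction f (g : 'I_n -> 'rV[R]_n -> R) v :
  (forall i x, is_derive x (delta_mx 0 i) f (g i x)) ->
  (forall i, continuous (g i)) ->
  forall x, is_derive x v f (\sum_i v 0 i * g i x).
Proof.
move=> df cg; suff H r y : is_derive y (\sum_(i <- r) v 0 i *: delta_mx 0 i) f
    (\sum_(i <- r) v 0 i * g i y).
  by move=> x; rewrite [X in is_derive _ X]row_sum_delta; exact: H.
elim: r y => [|i s IH] x.
  rewrite !big_nil; apply/is_deriveP => e e0; exists 1 => // t _.
  by rewrite scaler0 addr0 subrr mulr0 subrr normr0 mulr_ge0 // ltW.
rewrite !big_cons addrC [X in is_derive _ _ _ X]addrC.
exact: is_derive_combination.
Qed.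

Lemma is_derive_lincomb (c : 'I_n -> R) (F : 'I_n -> 'rV[R]_n -> R) x v (a : 'I_n -> R) :
  (forall j, is_derive x v (F j) (a j)) ->
  is_derive x v (fun y => \sum_j c j * F j y) (\sum_j c j * a j).
Proof.
move=> dF; elim: (index_enum _) => [|j s IH].
  rewrite big_nil (_ : (fun _ => _) = fun=> 0); first exact: is_derive_cst.
  by apply/funext => y; rewrite big_nil.
rewrite big_cons (_ : (fun _ => _) =
  (fun y => c j * F j y) + (fun y => \sum_(k <- s) c k * F k y)).
  by apply: is_deriveD => //; exact: is_deriveZ.
by apply/funext => y; rewrite big_cons.
Qed.

(** Rolle's theorem for [K] gives c below [h], and the mean value theorem for the first derivative
    over a segment of length factor 2c gives the point; the two displacements add to at most
    [3 * h]. *)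
Lemma second_difference f H x b (h : R) : has_hessian f H -> 0 < h ->
  exists2 s, `|s| <= 3 * h &
    f (x + h *: b) + f (x - h *: b) - 2 * f x = h ^+ 2 * qform (H (x + s *: b)) b.
Proof.
move=> [g [cf cg cH] [df dg]] h0.
pose G y := \sum_i b 0 i * g i y.
pose Q y := qform (H y) b.
have dfb y : is_derive y b f (G y) by exact: is_derive_direction.
have dfNb y : is_derive y (- b) f (- G y).
  have := is_derive_direction (- b) df cg y; rewrite /G -sumrN.
  by under eq_bigr do rewrite mxE mulNr.
have dG y : is_derive y b G (Q y).
  have dGi i z := is_derive_lincomb (b 0) (fun j => dg i j z).
  have cGi i : continuous (fun z => \sum_j b 0 j * H z i j).
    by apply: continuous_bigsum => j; exact: continuous_scale.
  have := is_derive_direction b dGi cGi y.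
  rewrite (_ : Q y = \sum_i b 0 i * \sum_j b 0 j * H y i j) //.
  rewrite /Q qformE; apply: eq_bigr => i _; rewrite mulr_sumr.
  by apply: eq_bigr => j _; ring.
(* Chosen so that [K h = K 0]. *)
pose a := (f (x + h *: b) + f (x - h *: b) - 2 * f x) / h ^+ 2.
pose K (t : R) : R := f (x + t *: b) + f (x + t *: - b) + - a * (t * t).
have dK (t : R) : is_derive t 1 K (G (x + t *: b) - G (x - t *: b) - 2 * a * t).
  have d1 := is_derive_line_at dfb x t; have d2 := is_derive_line_at dfNb x t.
  have d3 := is_deriveM (is_derive_id t 1) (is_derive_id t 1).
  have := is_deriveD (is_deriveD d1 d2) (is_deriveZ (- a) d3).
  rewrite scalerN; congr (is_derive _ _ _ _).
  by rewrite /GRing.scale /=; ring.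
have cK : continuous K.
  move=> t; apply/differentiable_continuous/derivable1_diffP.
  exact: (@ex_derive _ _ _ _ _ _ _ (dK t)).
have [c] := MVT h0 (fun t _ => dK t) (continuous_subspaceT cK).
rewrite in_itv /= => /andP[c0 ch].
have -> : K h - K 0 = 0.
  rewrite /K !scale0r !addr0 scalerN /a; field; exact: lt0r_neq0.
move=> /esym/eqP; rewrite subr0 mulf_eq0 (gt_eqF h0) orbF => /eqP Ec.
have [s sc E] := line_MVT dG (x - c *: b) (2 * c).
exists (s - c).
  apply: le_trans (ler_normB _ _) _; move: sc.
  rewrite normrM (gtr0_norm c0) ger0_norm //; lra.
have Ex : x - c *: b + (2 * c) *: b = x + c *: b.
  by rewrite -addrA -scaleNr -scalerDl; congr (_ + _ *: _); ring.
have Es : x - c *: b + s *: b = x + (s - c) *: b.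
  by rewrite -addrA -scaleNr -scalerDl [- c + s]addrC.
rewrite Ex Es in E.
have : 2 * c * Q (x + (s - c) *: b) = 2 * c * a by rewrite -E; move: Ec; lra.
rewrite -/(Q _) => /mulfI ->; last by rewrite mulf_neq0 // gt_eqF.
by rewrite [RHS]mulrC /a divfK // expf_neq0 // gt_eqF.
Qed.

End HasHessian.

Lemma ler_sum_in {R : numDomainType} {I : eqType} (s : seq I) (F G : I -> R) :
  (forall i, i \in s -> F i <= G i) -> \sum_(i <- s) F i <= \sum_(i <- s) G i.
Proof. by move=> FG; rewrite !big_seq; apply: ler_sum. Qed.

(** * Random walks *)

Section WeightedAverage.
Context {R : realType} {n : nat}.
Implicit Types (f g : 'rV[R]_n -> R) (x y z : 'rV[R]_n) (s : seq (R * 'rV[R]_n)).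

Definition wavg s f x : R := \sum_(p <- s) p.1 * f (x + p.2).

Definition weights s : Prop :=
  (forall p, p \in s -> 0 <= p.1) /\ \sum_(p <- s) p.1 = 1.

Lemma wavgD s f g x : wavg s (fun y => f y + g y) x = wavg s f x + wavg s g x.
Proof. by rewrite /wavg -big_split; apply: eq_bigr => p _; rewrite mulrDr. Qed.

Lemma wavgZ s (a : R) f x : wavg s (fun y => a * f y) x = a * wavg s f x.
Proof. by rewrite /wavg mulr_sumr; apply: eq_bigr => p _; rewrite mulrCA. Qed.

Lemma wavg_cst s (a : R) x : weights s -> wavg s (fun=> a) x = a.
Proof. by move=> [_ s1]; rewrite /wavg -mulr_suml s1 mul1r. Qed.

Lemma wavg_le s f g : weights s -> (forall y, f y <= g y) ->
  forall x, wavg s f x <= wavg s g x.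
Proof.
move=> [s0 _] fg x; rewrite /wavg; apply: ler_sum_in => p ps.
by rewrite ler_wpM2l ?s0.
Qed.

Lemma weighted_norm_le s (a : R * 'rV[R]_n -> R) (e : R) : weights s ->
  (forall p, p \in s -> `|a p| <= e) -> `|\sum_(p <- s) p.1 * a p| <= e.
Proof.
move=> [s0 s1] H; apply: le_trans (ler_norm_sum _ _ _) _.
rewrite -[leRHS]mul1r -s1 mulr_suml; apply: ler_sum_in => p ps.
by rewrite normrM ger0_norm ?s0 // ler_wpM2l ?s0 // H.
Qed.

Lemma wavg_continuous s f : continuous f -> continuous (wavg s f).
Proof.
move=> cf; apply: continuous_bigsum => p; apply: continuous_scale.
exact: continuous_shift.
Qed.

Lemma has_hessian_wavg s f H : has_hessian f H ->
  has_hessian (wavg s f) (fun x => \sum_(p <- s) p.1 *: H (x + p.2)).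
Proof.
move=> fH; rewrite /wavg; elim: s => [|p s IH].
  rewrite (_ : (fun _ => _) = fun=> 0); last by apply/funext => x; rewrite big_nil.
  rewrite (_ : (fun _ : 'rV_n => \sum_(_ <- _) _) = fun=> 0).
    exact: has_hessian_cst.
  by apply/funext => x; rewrite big_nil.
rewrite (_ : (fun _ => _) =
    fun x => p.1 * f (x + p.2) + \sum_(p <- s) p.1 * f (x + p.2)); last first.
  by apply/funext => x; rewrite big_cons.
rewrite (_ : (fun x => \sum_(_ <- _) _ *: _) =
    fun x => p.1 *: H (x + p.2) + \sum_(p <- s) p.1 *: H (x + p.2)).
  exact: has_hessianD (has_hessianZ _ (has_hessian_shift _ fH)) IH.
by apply/funext => x; rewrite big_cons.
Qed.

Lemma mollify_wavg d l s f : 0 < d -> continuous f ->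
  mollify d l (wavg s f) = wavg s (mollify d l f).
Proof.
move=> d0 cf; elim: s => [|p s IH].
  have E g : wavg [::] g = fun=> 0 by apply/funext => x; rewrite /wavg big_nil.
  by rewrite !E mollify_cst.
have E g : wavg (p :: s) g = fun x => p.1 * g (x + p.2) + wavg s g x.
  by apply/funext => x; rewrite /wavg big_cons.
rewrite !E mollifyD //; last exact: wavg_continuous.
  by rewrite mollifyZ ?mollify_shift ?IH //; exact: continuous_shift.
by apply: continuous_scale; exact: continuous_shift.
Qed.

End WeightedAverage.

Section RandomWalk.
Context {R : realType} {n : nat}.
Variable bs : seq 'rV[R]_n.
Hypothesis bs0 : (0 < size bs)%N.
Implicit Types (f g V : 'rV[R]_n -> R) (x y z b : 'rV[R]_n) (H : 'rV[R]_n -> 'M[R]_n).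

Let N : R := (size bs)%:R.

Definition elliptic_form (A : 'M[R]_n) : R := \sum_(b <- bs) qform A b.

Lemma elliptic_formD A B : elliptic_form (A + B) = elliptic_form A + elliptic_form B.
Proof. by rewrite -big_split; apply: eq_bigr => b _; rewrite qformD. Qed.

Lemma elliptic_formZ a A : elliptic_form (a *: A) = a * elliptic_form A.
Proof. by rewrite mulr_sumr; apply: eq_bigr => b _; rewrite qformZ. Qed.

Lemma elliptic_form0 : elliptic_form 0 = 0.
Proof. by rewrite -(scale0r 0) elliptic_formZ mul0r. Qed.

Lemma elliptic_form_sum {I : Type} (s : seq I) (F : I -> 'M[R]_n) :
  elliptic_form (\sum_(i <- s) F i) = \sum_(i <- s) elliptic_form (F i).
Proof.
by apply: (big_morph elliptic_form elliptic_formD elliptic_form0).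
Qed.

Definition walk (h : R) : seq (R * 'rV[R]_n) :=
  [seq ((2 * N)^-1, h *: b) | b <- bs] ++ [seq ((2 * N)^-1, - (h *: b)) | b <- bs].

(** The time of one step in the scale in which [elliptic_form] of the Hessian is the generator of
    the walk. *)
Definition walk_time (h : R) : R := h ^+ 2 / (2 * N).

Lemma size_gt0 : 0 < N. Proof. by rewrite ltr0n. Qed.
Let N0 := size_gt0.

Lemma walk_time_gt0 h : 0 < h -> 0 < walk_time h.
Proof. by move=> h0; rewrite divr_gt0 ?exprn_gt0 ?mulr_gt0. Qed.

Lemma wavg_walk h f x : wavg (walk h) f x =
  (2 * N)^-1 * \sum_(b <- bs) (f (x + h *: b) + f (x - h *: b)).
Proof.
by rewrite /wavg big_cat !big_map /= -!mulr_sumr -mulrDr -big_split.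
Qed.

Lemma sum_cst (a : R) : \sum_(b <- bs) a = N * a.
Proof. by rewrite big_const_seq count_predT iter_addr_0 mulr_natl. Qed.

Lemma weights_walk h : weights (walk h).
Proof.
split=> [p|].
  rewrite mem_cat => /orP[] /mapP[b _ ->] /=; rewrite invr_ge0 mulr_ge0 //;
  exact: ltW.
rewrite big_cat !big_map /= sum_cst; field; exact: lt0r_neq0.
Qed.

(* The last clause is a uniform modulus of continuity of the second
   derivatives in the directions of the walk; averages of translates keep it. *)
Definition tame (e r : R) f H : Prop :=
  [/\ has_hessian f H, forall x, H x \is symmetricmx &
      forall x y b, b \in bs -> `|x - y| < r ->
        `|qform (H x) b - qform (H y) b| <= e].

Lemma symmetricmx_sum {I : Type} (s : seq I) (F : I -> 'M[R]_n) :
  (forall i, F i \is symmetricmx) -> \sum_(i <- s) F i \is symmetricmx.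
Proof.
move=> Fs; apply: (big_ind (fun A : 'M[R]_n => A \is symmetricmx)) => //.
  by apply/symmetricmxP; rewrite trmx0.
move=> A B /symmetricmxP As /symmetricmxP Bs.
by apply/symmetricmxP; rewrite linearD /= -As -Bs.
Qed.

Lemma symmetricmxZ (a : R) (A : 'M[R]_n) : A \is symmetricmx -> a *: A \is symmetricmx.
Proof. by move=> /symmetricmxP As; apply/symmetricmxP; rewrite linearZ /= -As. Qed.

Lemma qform_sum {I : Type} (s : seq I) (F : I -> 'M[R]_n) b :
  qform (\sum_(i <- s) F i) b = \sum_(i <- s) qform (F i) b.
Proof.
apply: (big_morph (fun A => qform A b)); first by move=> *; exact: qformD.
by rewrite -(scale0r 0) qformZ mul0r.
Qed.

Lemma tame_wavg e r s f H : weights s -> tame e r f H ->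
  tame e r (wavg s f) (fun x => \sum_(p <- s) p.1 *: H (x + p.2)).
Proof.
move=> ws [fH Hs mH]; split; first exact: has_hessian_wavg.
  by move=> x; apply: symmetricmx_sum => p; exact: symmetricmxZ.
move=> x y b bb xy; rewrite !qform_sum -sumrB.
under eq_bigr do rewrite !qformZ -mulrBr.
apply: (weighted_norm_le ws) => p _; apply: mH => //.
by rewrite opprD addrACA subrr addr0.
Qed.

Lemma walk_consistent e r f H h x : tame e r f H -> 0 < h ->
  (forall b, b \in bs -> 3 * h * `|b| < r) ->
  `|wavg (walk h) f x - f x - walk_time h * elliptic_form (H x)|
    <= walk_time h * (N * e).
Proof.
move=> [fH Hs mH] h0 hr.
have -> : wavg (walk h) f x - f x - walk_time h * elliptic_form (H x) =
  (2 * N)^-1 * \sum_(b <- bs)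
    (f (x + h *: b) + f (x - h *: b) - 2 * f x - h ^+ 2 * qform (H x) b).
  rewrite wavg_walk [in RHS]sumrB [in RHS]sumrB sum_cst -mulr_sumr /walk_time.
  rewrite /elliptic_form; field; exact: lt0r_neq0.
have -> : walk_time h * (N * e) = (2 * N)^-1 * \sum_(b <- bs) h ^+ 2 * e.
  by rewrite sum_cst /walk_time; ring.
rewrite normrM ger0_norm ?invr_ge0 ?mulr_ge0 ?(ltW N0) //.
rewrite ler_wpM2l ?invr_ge0 ?mulr_ge0 ?(ltW N0) //.
apply: le_trans (ler_norm_sum _ _ _) _; apply: ler_sum_in => b bb.
have [t th ->] := second_difference x b fH h0.
rewrite -mulrBr normrM ger0_norm ?sqr_ge0 // ler_wpM2l ?sqr_ge0 //.
apply: mH => //; rewrite addrAC subrr add0r normrZ.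
by apply: le_lt_trans (hr _ bb); rewrite ler_wpM2r.
Qed.

Lemma elliptic_form_near e r f H x y : tame e r f H -> `|x - y| < r ->
  `|elliptic_form (H x) - elliptic_form (H y)| <= N * e.
Proof.
move=> [_ _ mH] xy; rewrite /elliptic_form -sumrB -sum_cst.
apply: le_trans (ler_norm_sum _ _ _) _; apply: ler_sum_in => b bb.
exact: mH.
Qed.

(* Discrete comparison: at a positive maximum of k minus an iterate of the
   walk, that iterate is a test function for k. *)
Lemma subsolution_le_walk (k kap : 'rV[R]_n -> R) (K : set 'rV[R]_n) (c e r h : R) Hk :
  0 <= c -> 0 <= e -> continuous k -> (forall x, 0 <= k x) ->
  compact K -> (forall x, ~ K x -> k x = 0) ->
  (forall psi H x, has_hessian psi H -> (forall y, H y \is symmetricmx) ->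
    0 < k x -> (forall y, k y - psi y <= k x - psi x) -> - c <= elliptic_form (H x)) ->
  tame e r kap Hk -> (forall x, k x <= kap x) ->
  0 < h -> (forall b, b \in bs -> 3 * h * `|b| < r) ->
  forall j x, k x <= iter j (wavg (walk h)) kap x +
    j%:R * walk_time h * (c + 2 * (N * e)).
Proof.
move=> c0 e0 ck k0 cK kK visc tk kkap h0 hr j.
set t := walk_time h; have t0 : 0 < t := walk_time_gt0 h0.
have ws := weights_walk h.
have tj m : exists H, tame e r (iter m (wavg (walk h)) kap) H.
  elim: m => [|m [H tH]]; first by exists Hk.
  by eexists; exact: tame_wavg tH.
have pos m x : 0 <= iter m (wavg (walk h)) kap x.
  elim: m x => [|m IH] x /=; first exact: le_trans (kkap x).
  by rewrite -(wavg_cst (s := walk h) 0 x) //; exact: wavg_le.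
elim: j => [|j IH] x; first by rewrite !mul0r addr0.
rewrite leNgt; apply/negP => kx.
set f := iter j (wavg (walk h)) kap in IH.
have [H tH] := tj j.
pose psi := wavg (walk h) f.
pose Hpsi x := \sum_(p <- walk h) p.1 *: H (x + p.2).
have tpsi : tame e r psi Hpsi := tame_wavg ws tH.
have posM m : 0 <= m%:R * t * (c + 2 * (N * e)).
  apply: mulr_ge0; first by rewrite mulr_ge0 ?ler0n ?ltW.
  by rewrite addr_ge0 // !mulr_ge0 // ltW.
have kpx : psi x < k x by apply: le_lt_trans kx; rewrite lerDl posM.
(* The iterates stay nonnegative while [k] vanishes off [K], so an excess occurs only in [K], where
   a maximum exists. *)
have Kx : K x.
  apply: contrapT => /kK kx0; move: kpx; rewrite kx0.
  by have := pos j.+1 x; rewrite /= -/f -/psi; lra.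
have cpsi : continuous psi by case: tpsi => /has_hessian_continuous.
have cdiff : continuous (fun y => k y + -1 * psi y).
  by apply: continuous_add => //; exact: continuous_scale.
have [|x1 Kx1 mx1] := compact_continuous_max cK _ cdiff; first by exists x.
have mx y : k y - psi y <= k x1 - psi x1.
  have [/mx1|/kK ky] := pselect (K y); first by rewrite !mulN1r.
  have := mx1 x Kx; rewrite !mulN1r ky; have := pos j.+1 y.
  by rewrite /= -/f -/psi => h1 h2; lra.
have kx1 : 0 < k x1.
  by have := mx x; have := pos j.+1 x1; rewrite /= -/f -/psi => h1 h2; lra.
have vx := visc psi Hpsi x1 (let: And3 a _ _ := tpsi in a)
  (let: And3 _ a _ := tpsi in a) kx1 mx.
(* The Hessian of [psi] averages that of [f] over points one step away. This costs one [N * e] per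
   unit of time and the consistency of the walk another, hence the factor 2 in the claim. *)
have Ediff : `|elliptic_form (Hpsi x1) - elliptic_form (H x1)| <= N * e.
  rewrite /Hpsi elliptic_form_sum.
  rewrite -[X in _ - X](wavg_cst (s := walk h) _ x1) // /wavg -sumrB.
  under eq_bigr do rewrite elliptic_formZ -mulrBr.
  apply: (weighted_norm_le ws) => p pw; apply: (elliptic_form_near tH).
  rewrite addrAC subrr add0r.
  have [b bb ->] : exists2 b, b \in bs & `|p.2| = `|h *: b|.
    move: pw; rewrite mem_cat => /orP[] /mapP[b bb ->]; exists b => //=.
    by rewrite normrN.
  rewrite normrZ gtr0_norm //; apply: le_lt_trans (hr _ bb).
  by rewrite ler_wpM2r // ler_peMl ?(ltW h0) // ler1n.
have Ew := walk_consistent x1 tH h0 hr.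
move: Ediff Ew; rewrite -/t -/psi !ler_norml => /andP[_ E2] /andP[E3 _].
have E4 : - (t * c) - t * (N * e) <= t * elliptic_form (H x1).
  by rewrite -mulrN -mulrBr ler_wpM2l ?(ltW t0) //; lra.
have E5 : j.+1%:R * t * (c + 2 * (N * e)) =
    j%:R * t * (c + 2 * (N * e)) + t * c + 2 * (t * (N * e)).
  by rewrite -natr1; ring.
have := IH x1; have := mx x; move: kx E3 E4; rewrite E5 /= -/f -/psi; lra.
Qed.

End RandomWalk.

(** * Growth of smooth functions along the walk *)

Section Growth.
Context {R : realType} {n : nat}.
Variable bs : seq 'rV[R]_n.
Hypothesis bs0 : (0 < size bs)%N.
Implicit Types (f g V : 'rV[R]_n -> R) (x y z b : 'rV[R]_n) (H : 'rV[R]_n -> 'M[R]_n).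

Let N : R := (size bs)%:R.
Let N0 := size_gt0 (R := R) bs0.

Lemma qform1E x : qform 1%:M x = \sum_i x 0 i ^+ 2.
Proof.
by rewrite /qform mulmx1 mxE; apply: eq_bigr => i _; rewrite mxE expr2.
Qed.

Lemma qform1_ge0 x : 0 <= qform 1%:M x.
Proof. by rewrite qform1E sumr_ge0 // => i _; exact: sqr_ge0. Qed.

Lemma symmetricmx1 (a : R) : (a%:M : 'M[R]_n) \is symmetricmx.
Proof. by apply/symmetricmxP; rewrite tr_scalar_mx. Qed.

(** The constant part of the bound on the generator integrates to [beta] times the elapsed time. The
    quadratic part is controlled by the mean square displacement, which grows linearly in time at
    rate [elliptic_form bs (2 *: 1%:M)]. *)
Lemma walk_growth e r V H x0 (beta C h : R) : tame bs e r V H -> 0 <= C -> 0 < h ->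
  (forall b, b \in bs -> 3 * h * `|b| < r) ->
  (forall x, elliptic_form bs (H x) <= beta + C * qform 1%:M (x - x0)) ->
  forall j x, iter j (wavg (walk bs h)) V x <=
    V x + j%:R * walk_time bs h * (beta + N * e) +
    C * (j%:R * walk_time bs h) * (qform 1%:M (x - x0) +
      j%:R * walk_time bs h * elliptic_form bs (2 *: 1%:M)).
Proof.
move=> tV C0 h0 hr Hle.
set t := walk_time bs h; have t0 : 0 < t := walk_time_gt0 bs0 h0.
set sig := elliptic_form bs _.
have sig0 : 0 <= sig.
  by rewrite /sig elliptic_formZ mulr_ge0 // sumr_ge0 // => b _; exact: qform1_ge0.
have ws := weights_walk bs0 h.
have tq : tame bs 0 r (fun y => qform 1%:M (y + - x0)) (fun=> 2 *: 1%:M).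
  split; first exact: (has_hessian_shift (- x0) (has_hessian_qform (symmetricmx1 1))).
    by move=> _; apply: symmetricmxZ; exact: symmetricmx1.
  by move=> *; rewrite subrr normr0.
elim=> [|j IH] x; first by rewrite !(mul0r, mulr0, addr0) lexx.
set J := j%:R * t in IH.
have J0 : 0 <= J by rewrite mulr_ge0 ?ler0n ?ltW.
have [A AE] : exists A, A = J * (beta + N * e) + C * J * (J * sig) by eexists.
have : wavg (walk bs h) (iter j (wavg (walk bs h)) V) x <=
    wavg (walk bs h) (fun y => V y + (A + C * J * qform 1%:M (y - x0))) x.
  by apply: wavg_le => // y; apply: le_trans (IH y) _; rewrite AE; lra.
rewrite wavgD wavgD wavgZ wavg_cst // => le1.
have := walk_consistent bs0 x tV h0 hr; have := walk_consistent bs0 x tq h0 hr.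
rewrite -/t -/sig -/N !mulr0 !ler_norml => /andP[_ q1] /andP[_ v1].
apply: le_trans le1 _.
have v2 : t * elliptic_form bs (H x) <= t * (beta + C * qform 1%:M (x - x0)).
  by rewrite ler_wpM2l // ltW.
have q2 : C * J * wavg (walk bs h) (fun y => qform 1%:M (y - x0)) x <=
    C * J * (qform 1%:M (x - x0) + t * sig).
  by rewrite ler_wpM2l ?mulr_ge0 //; lra.
have E : j.+1%:R * t = J + t by rewrite -natr1 mulrDl mul1r.
(* The claimed bound contains C sig times the square of [J + t]; these are the parts of it that the
   recursion does not produce. *)
have p1 : 0 <= C * (J * (t * sig)) by rewrite !mulr_ge0 // ltW.
have p2 : 0 <= C * (t * (t * sig)) by rewrite !mulr_ge0 // ltW.
rewrite E AE; move: v1 v2 q2 p1 p2; move: (wavg _ _ _) (wavg _ _ _) => a1 a2.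
move: (qform _ _) (elliptic_form _ (H x)) (V x) (N * e) => q l v Ne.
nra.
Qed.

Lemma qform_le (a : R) (A : 'M[R]_n) b : (forall i j, `|A i j| <= a) ->
  `|qform A b| <= a * (\sum_i `|b 0 i|) ^+ 2.
Proof.
move=> Aa; rewrite qformE expr2 mulr_suml mulr_sumr.
apply: le_trans (ler_norm_sum _ _ _) _; apply: ler_sum => i _.
rewrite !mulr_sumr; apply: le_trans (ler_norm_sum _ _ _) _; apply: ler_sum => j _.
by rewrite !normrM mulrA [a * _]mulrC ler_wpM2r // ler_wpM2l.
Qed.

Lemma elliptic_form_le (a : R) (A : 'M[R]_n) : (forall i j, `|A i j| <= a) ->
  `|elliptic_form bs A| <= a * \sum_(b <- bs) (\sum_i `|b 0 i|) ^+ 2.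
Proof.
move=> Aa; rewrite mulr_sumr; apply: le_trans (ler_norm_sum _ _ _) _.
by apply: ler_sum => b _; exact: qform_le.
Qed.

End Growth.

(** * Mollification of supersolutions *)

Section Moll.
Context {R : realType} {n : nat}.
Implicit Types (f g k : 'rV[R]_n -> R) (x y z b : 'rV[R]_n) (d : R) (i j : 'I_n).

Definition twice : seq 'I_n := enum 'I_n ++ enum 'I_n.

Lemma mem_rem_twice i j : i \in rem j twice.
Proof.
rewrite -has_pred1 has_count count_mem_rem.
have -> : count_mem i twice = 2.
  by rewrite count_cat !count_uniq_mem ?enum_uniq // mem_enum.
by case: (_ == _).
Qed.

(* Averaging twice in each coordinate gains two continuous derivatives. *)
Definition moll d f : 'rV[R]_n -> R := mollify d twice f.

(** Each derivative has consumed one average. What is left averages a second difference quotient, so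
    it is linear in [f] and inherits bounds and moduli up to a factor 1 / d^2. *)
Definition moll_hess d f x : 'M[R]_n :=
  \matrix_(i, j) mollify d (rem i (rem j twice)) (diffq d i (diffq d j f)) x.

Lemma moll_has_hessian d f : 0 < d -> continuous f ->
  has_hessian (moll d f) (moll_hess d f).
Proof. by move=> d0 cf; apply: has_hessian_mollify => // i j; exact: mem_rem_twice. Qed.

Lemma moll_hess_sym d f x : moll_hess d f x \is symmetricmx.
Proof.
by apply/symmetricmxP/matrixP => i j; rewrite !mxE remAC diffqC.
Qed.

Lemma moll_near d f x (r e : R) : 0 < d -> continuous f -> d *+ size twice < r ->
  (forall y, `|y - x| < r -> `|f y - f x| <= e) -> `|moll d f x - f x| <= e.
Proof.
move=> d0 cf dr H; apply: mollify_near => // y yx; apply: H.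
exact: le_lt_trans dr.
Qed.

Lemma diffq_continuous2 d f i j : continuous f -> continuous (diffq d i (diffq d j f)).
Proof. by move=> cf; do 2 apply: diffq_continuous. Qed.

Lemma diffq_sub_le d f i x y (e : R) : 0 < d ->
  (forall z, `|f (x + z) - f (y + z)| <= e) ->
  forall z, `|diffq d i f (x + z) - diffq d i f (y + z)| <= e / d.
Proof.
move=> d0 H z; rewrite /diffq -mulrBr normrM ger0_norm; last first.
  by rewrite invr_ge0 mulr_ge0 // ltW.
have -> : e / d = (2 * d)^-1 * (e + e) by field; exact: lt0r_neq0.
rewrite ler_wpM2l //; first by rewrite invr_ge0 mulr_ge0 // ltW.
rewrite opprD addrACA -opprD; apply: le_trans (ler_normB _ _) _.
by rewrite -!addrA lerD // opprK addrC distrC.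
Qed.

Lemma diffq_le d f i (B : R) : 0 < d -> (forall x, `|f x| <= B) ->
  forall x, `|diffq d i f x| <= B / d.
Proof.
move=> d0 H x; rewrite /diffq normrM ger0_norm; last first.
  by rewrite invr_ge0 mulr_ge0 // ltW.
have -> : B / d = (2 * d)^-1 * (B + B) by field; exact: lt0r_neq0.
rewrite ler_wpM2l //; first by rewrite invr_ge0 mulr_ge0 // ltW.
by apply: le_trans (ler_normB _ _) _; rewrite lerD.
Qed.

Lemma moll_hess_modulus d f (r e : R) : 0 < d -> continuous f ->
  (forall x y, `|x - y| < r -> `|f x - f y| <= e) ->
  forall x y, `|x - y| < r -> forall i j,
    `|(moll_hess d f x - moll_hess d f y) i j| <= e / d / d.
Proof.
move=> d0 cf H x y xy i j; rewrite !mxE.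
apply: (@mollify_modulus _ _ _ _ _ _ r) => //; first exact: diffq_continuous2.
move=> {xy}x {}y xy.
have := @diffq_sub_le d (diffq d j f) i x y (e / d) d0 _ 0; rewrite !addr0; apply.
apply: diffq_sub_le => // z; apply: H.
by rewrite opprD addrACA subrr addr0.
Qed.

Lemma moll_hess_le d f (B : R) : 0 < d -> continuous f -> (forall x, `|f x| <= B) ->
  forall x i j, `|moll_hess d f x i j| <= B / d / d.
Proof.
move=> d0 cf H x i j; rewrite mxE -[X in `|X|]subr0.
apply: mollify_near => //; first exact: diffq_continuous2.
by move=> y _; rewrite subr0; do 2 apply: diffq_le => //.
Qed.

Lemma norm_le_qform1 x : `|x| ^+ 2 <= qform 1%:M x.
Proof.
have q0 := qform1_ge0 x; rewrite -(sqr_sqrtr q0) ler_pXn2r ?nnegrE ?sqrtr_ge0 //.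
rewrite [leLHS]/Num.norm /= mx_normrE; apply/bigmax_leP; split; first exact: sqrtr_ge0.
move=> [i j] _ /=; rewrite ord1 -sqrtr_sqr ler_wsqrtr // qform1E (bigD1 j) //=.
by rewrite lerDl sumr_ge0 // => l _; exact: sqr_ge0.
Qed.

Lemma moll_tame (bs : seq 'rV[R]_n) d f : 0 < d -> continuous f ->
  (forall e : R, 0 < e -> exists2 r : R, 0 < r &
     forall x y, `|x - y| < r -> `|f x - f y| <= e) ->
  forall e : R, 0 < e -> exists2 r : R, 0 < r & tame bs e r (moll d f) (moll_hess d f).
Proof.
move=> d0 cf H e e0.
(* Bounds the factor lost in passing from matrix entries to the form in any direction of [bs]; the
   summand 1 keeps it positive. *)
pose C := 1 + \sum_(b <- bs) (\sum_i `|b 0 i|) ^+ 2.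
have C0 : 0 < C by rewrite ltr_wpDr // sumr_ge0 // => b _; exact: sqr_ge0.
have [r r0 Hr] := H (e / C * d * d) (mulr_gt0 (mulr_gt0 (divr_gt0 e0 C0) d0) d0).
exists r => //; split; first exact: moll_has_hessian.
  by move=> x; exact: moll_hess_sym.
move=> x y b bb xy; rewrite -qformN -qformD.
apply: le_trans (qform_le _ (moll_hess_modulus d0 cf Hr xy)) _.
rewrite !mulfK ?gt_eqF // mulrAC ler_pdivrMr // ler_wpM2l ?(ltW e0) //.
rewrite /C (big_rem b) //= addrCA lerDl addr_ge0 // sumr_ge0 // => b' _.
exact: sqr_ge0.
Qed.

(* If elliptic_form were below - c at x0, the walk started there would decrease
   moll d k at a rate exceeding c, against subsolution_le_walk. *)
Lemma moll_subsolution (bs : seq 'rV[R]_n) k (K : set 'rV[R]_n) (c d : R) :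
  (0 < size bs)%N -> 0 <= c -> 0 < d -> continuous k -> (forall x, 0 <= k x) ->
  compact K -> (forall x, ~ K x -> k x = 0) ->
  (forall psi H x, has_hessian psi H -> (forall y, H y \is symmetricmx) ->
    0 < k x -> (forall y, k y - psi y <= k x - psi x) ->
    - c <= elliptic_form bs (H x)) ->
  forall x, - c <= elliptic_form bs (moll_hess d k x).
Proof.
move=> bs0 c0 d0 ck k0 cK kK visc x0; rewrite leNgt; apply/negP => Hx0.
have ku : forall e : R, 0 < e -> exists2 r : R, 0 < r &
     forall x y, `|x - y| < r -> `|k x - k y| <= e.
  move=> e e0.
  have [r r0 Hr] := continuous_uniform_near_compact cK ck e0.
  exists r => // x y xy.
  have [Ky|/kK ky] := pselect (K y); first exact: Hr.
  have [Kx|/kK kx] := pselect (K x); last by rewrite kx ky subrr normr0 ltW.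
  by rewrite distrC; apply: Hr => //; rewrite distrC.
have [B kB] : exists B, forall x, `|k x| <= B.
  have [[x Kx]|K0] := pselect (K !=set0); last first.
    exists 0 => x; rewrite kK ?normr0 // => Kx; apply: K0; by exists x.
  have [|x1 Kx1 mx1] := compact_continuous_max cK _ ck; first by exists x.
  exists (k x1) => y; rewrite ger0_norm //.
  by have [/mx1|/kK ->] := pselect (K y).
set N : R := (size bs)%:R; have N0 : 0 < N := size_gt0 bs0.
(* Of the four quarters of the defect, one is given up to oscillation near [x0], one to the errors
   [3 * (N * e)], one to the quadratic spread, and half of the last to smoothing [k]. *)
pose eps := (- c - elliptic_form bs (moll_hess d k x0)) / 4.
have eps0 : 0 < eps by rewrite divr_gt0 // subr_gt0.
pose e := eps / (3 * N).
have e0 : 0 < e by rewrite divr_gt0 // mulr_gt0.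
have NeE : 3 * (N * e) = eps by rewrite /e; field; exact: lt0r_neq0.
have [r1 r10 tV] := moll_tame bs d0 ck ku e0.
pose Q := \sum_(b <- bs) (\sum_i `|b 0 i|) ^+ 2.
pose B1 := B / d / d * Q.
have ellB x : `|elliptic_form bs (moll_hess d k x)| <= B1.
  by apply: elliptic_form_le; exact: moll_hess_le.
(* Beyond distance [r1] the paraboloid is at least [2 * B1], the whole range of the form, so the
   bound [Hle] holds globally. *)
pose C := 2 * B1 / r1 ^+ 2.
have B10 : 0 <= B1 by apply: le_trans (ellB x0).
have C0 : 0 <= C by rewrite divr_ge0 ?sqr_ge0 // mulr_ge0.
have Hle x : elliptic_form bs (moll_hess d k x) <=
    (- c - 3 * eps) + C * qform 1%:M (x - x0).
  have E : elliptic_form bs (moll_hess d k x0) = - c - 4 * eps by rewrite /eps; field.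
  have q0 : 0 <= C * qform 1%:M (x - x0) by rewrite mulr_ge0 // qform1_ge0.
  have [near0|far] := ltP `|x - x0| r1.
    have := elliptic_form_near tV near0; rewrite -/N E ler_norml => /andP[_].
    by move: NeE; move: (N * e) => Ne; lra.
  have : 2 * B1 <= C * qform 1%:M (x - x0).
    rewrite -[leLHS](@divfK _ (r1 ^+ 2)) ?expf_neq0 ?gt_eqF //.
    rewrite ler_wpM2l // (le_trans _ (norm_le_qform1 _)) //.
    by rewrite ler_pXn2r ?nnegrE ?(ltW r10).
  have := ellB x; have := ellB x0; rewrite E !ler_norml => /andP[h1 h2] /andP[h3 h4].
  lra.
set sig := elliptic_form bs (2 *: 1%:M : 'M[R]_n).
have sig0 : 0 <= sig.
  by rewrite /sig elliptic_formZ mulr_ge0 // sumr_ge0 // => b _; exact: qform1_ge0.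
have D0 : 0 < 1 + C * sig by rewrite ltr_wpDr // mulr_ge0.
(* Time horizon: as long as the elapsed time J is at most [t0], the spread [C * J * (J * sig)] is at
   most [J * eps]. *)
pose t0 := eps / (1 + C * sig).
have t00 : 0 < t0 by rewrite divr_gt0.
pose eta := t0 * eps / 8.
have eta0 : 0 < eta by rewrite divr_gt0 // mulr_gt0.
have [r2 r20 Hr2] := ku _ eta0.
pose d' := r2 / (1 + (size twice)%:R).
have s0 : 0 < 1 + (size twice)%:R :> R by rewrite ltr_wpDr.
have d'0 : 0 < d' by rewrite divr_gt0.
have d'r : d' *+ size twice < r2.
  rewrite -mulr_natr /d' mulrAC ltr_pdivrMr // ltr_pM2l // ltrDr //.
have kd' x : `|moll d' k x - k x| <= eta.
  by apply: (moll_near d'0 ck d'r) => y yx; exact: Hr2.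
(* The walk must start from a smooth function above [k]: a second mollification within [eta] of [k],
   raised by [eta]. *)
pose kap x := moll d' k x + eta.
have [r3 r30 [m1 m2 m3]] := moll_tame bs d'0 ck ku e0.
pose r := Num.min r1 r3.
have r0 : 0 < r by rewrite lt_min r10.
have tVr : tame bs e r (moll d k) (moll_hess d k).
  case: tV => h1 h2 h3; split=> // x y b bb; rewrite lt_min => /andP[+ _].
  exact: h3.
have tkap : tame bs e r kap (fun x => moll_hess d' k x + 0).
  split.
  - exact: has_hessianD m1 (has_hessian_cst eta).
  - by move=> x; rewrite addr0; exact: m2.
  - by move=> x y b bb; rewrite lt_min !addr0 => /andP[_]; exact: m3.
have kkap x : k x <= kap x.
  by have := kd' x; rewrite ler_norml /kap => /andP[h1 _]; lra.
have kapk x : kap x <= k x + 2 * eta.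
  by have := kd' x; rewrite ler_norml /kap => /andP[_ h1]; lra.
pose Bm := 1 + \sum_(b <- bs) `|b|.
have Bm0 : 0 < Bm by rewrite ltr_wpDr // sumr_ge0.
(* The bounds 1 and [t0] give [h ^+ 2 <= t0], so one step takes at most half the horizon; the last
   keeps the displacements [3 * h] along [bs] within the range [r] of the modulus. *)
pose h := Num.min (Num.min 1 t0) (r / (6 * Bm)).
have h0 : 0 < h by rewrite !lt_min ltr01 t00 divr_gt0 // mulr_gt0.
have h1 : h <= 1 by rewrite !ge_min lexx.
have ht : h <= t0 by rewrite !ge_min lexx orbT.
have hr b : b \in bs -> 3 * h * `|b| < r.
  move=> bb; have bB : `|b| <= Bm.
    by rewrite /Bm (big_rem b) //= addrCA lerDl addr_ge0 // sumr_ge0.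
  have hB : h * (6 * Bm) <= r.
    by rewrite -ler_pdivlMr ?mulr_gt0 // !ge_min lexx orbT.
  have : h * `|b| <= h * Bm by rewrite ler_wpM2l // ltW.
  lra.
set t := walk_time bs h; have tt0 : 0 < t := walk_time_gt0 bs0 h0.
have tle : 2 * t <= t0.
  rewrite /t /walk_time -/N (_ : 2 * _ = h ^+ 2 / N); last by field; exact: lt0r_neq0.
  rewrite ler_pdivrMr //; have N1 : 1 <= N by rewrite ler1n.
  have : h * h <= 1 * t0 by apply: ler_pM => //; exact: ltW.
  have : t0 * 1 <= t0 * N by rewrite ler_wpM2l // ltW.
  rewrite expr2; lra.
(* The horizon is filled up to one step, so the elapsed time lies between [t0 / 2] and [t0]. *)
have [j jt tj] : exists2 j : nat, j%:R * t <= t0 & t0 < j.+1%:R * t.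
  exists (Num.truncn (t0 / t)).
    by rewrite -ler_pdivlMr // truncn_le // divr_ge0 // ltW.
  by rewrite -ltr_pdivrMr // truncnS_gt.
have sub := subsolution_le_walk bs0 c0 (ltW e0) ck k0 cK kK visc tkap kkap h0 hr j.
have gro := walk_growth bs0 tVr C0 h0 hr Hle j x0.
rewrite -/t -/N -/sig in sub gro.
set T := wavg (walk bs h) in sub gro.
have ws := weights_walk bs0 h.
have Tc m f : continuous f -> continuous (iter m T f).
  by move=> cf; elim: m => //= m; exact: wavg_continuous.
have Tmono m f g : (forall x, f x <= g x) -> forall x, iter m T f x <= iter m T g x.
  by move=> fg; elim: m => //= m IH; exact: wavg_le.
have Tmoll m f : continuous f -> mollify d twice (iter m T f) = iter m T (mollify d twice f).
  by move=> cf; elim: m => //= m IH; rewrite mollify_wavg ?IH //; exact: Tc.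
have Tadd m f (a : R) x : iter m T (fun y => f y + a) x = iter m T f x + a.
  elim: m x => //= m IH x; rewrite -[X in _ + X](wavg_cst (s := walk bs h) a x) // -wavgD.
  by congr (wavg _ _ x); apply/funext => y; rewrite IH.
have ckap : continuous kap by case: tkap => /has_hessian_continuous.
set J := j%:R * t in sub gro jt tj.
pose a := J * (c + 2 * (N * e)) + 2 * eta.
(* The walk commutes with mollification, so mollifying the comparison for [k] gives one for
   [moll d k], which contradicts the growth bound. *)
have : moll d k x0 <= iter j T (moll d k) x0 + a.
  have -> : iter j T (moll d k) x0 + a =
      mollify d twice (fun x => iter j T k x + a) x0.
    rewrite mollifyD ?mollify_cst ?Tmoll //; first exact: Tc.
    exact: cst_continuous.
  apply: mollify_le => //.
    by apply: continuous_add; [exact: Tc|exact: cst_continuous].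
  move=> y _; have := sub y; have := Tmono j _ _ kapk y; rewrite Tadd /a; lra.
have Jt0 : t0 <= 2 * J by move: tj; rewrite -natr1 mulrDl mul1r -/J; lra.
have CJ : C * J * (J * sig) <= J * eps.
  have p : t0 * (1 + C * sig) = eps by rewrite /t0 divfK // gt_eqF.
  have J0 : 0 <= J by lra.
  have : J * (C * sig) <= t0 * (C * sig) by rewrite ler_wpM2r // mulr_ge0.
  rewrite mulrDr mulr1 in p => q.
  rewrite (_ : C * J * (J * sig) = J * (J * (C * sig))); last by ring.
  by rewrite ler_wpM2l //; lra.
have q00 : qform 1%:M (x0 - x0) = 0 :> R.
  by rewrite subrr /qform mul0mx mul0mx mxE.
have JNe : J * (3 * (N * e)) = J * eps by rewrite NeE.
have t0e : t0 * eps <= 2 * J * eps by rewrite ler_wpM2r // ltW.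
move: gro; rewrite q00 add0r /a => gro.
have eE : 8 * eta = t0 * eps by rewrite /eta; field.
have t0e0 : 0 < t0 * eps by rewrite mulr_gt0.
(* The two estimates at [x0] add up to [0 <= 2 * eta - J * eps], while [2 * eta <= J * eps / 2] and
   J is positive. *)
nra.
Qed.

End Moll.

(** * Localization of the mollified inequality *)

Section LocalSupersolution.
Context {R : realType} {n : nat}.
Implicit Types (f g k w : 'rV[R]_n -> R) (x y z b : 'rV[R]_n) (d : R) (i j : 'I_n).

Lemma diffqD d i f g : diffq d i (fun y => f y + g y) = fun x => diffq d i f x + diffq d i g x.
Proof. by apply/funext => x; rewrite /diffq; ring. Qed.

Lemma diffqZ d i (a : R) f : diffq d i (fun y => a * f y) = fun x => a * diffq d i f x.
Proof. by apply/funext => x; rewrite /diffq; ring. Qed.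

Lemma moll_hessD d f g x : 0 < d -> continuous f -> continuous g ->
  moll_hess d (fun y => f y + g y) x = moll_hess d f x + moll_hess d g x.
Proof.
move=> d0 cf cg; apply/matrixP => i j; rewrite !mxE (diffqD _ _ f g) diffqD mollifyD //;
  exact: diffq_continuous2.
Qed.

Lemma moll_hessZ d (a : R) f x : 0 < d -> continuous f ->
  moll_hess d (fun y => a * f y) x = a *: moll_hess d f x.
Proof.
move=> d0 cf; apply/matrixP => i j.
rewrite !mxE (diffqZ _ _ a f) (diffqZ _ _ a (diffq d j f)) mollifyZ //;
  exact: diffq_continuous2.
Qed.

Lemma moll_hess_cst d (a : R) x : 0 < d -> moll_hess d (fun=> a) x = 0.
Proof.
move=> d0; apply/matrixP => i j; rewrite !mxE.
rewrite (_ : diffq d i _ = fun=> 0) ?mollify_cst //.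
by apply/funext => y; rewrite /diffq !subrr mulr0.
Qed.

(** Symmetric difference quotients are exact on quadratic polynomials, and averages fix
    constants. *)
Lemma moll_hess_qform d (A : 'M[R]_n) z x : 0 < d -> A \is symmetricmx ->
  moll_hess d (fun y => qform A (y - z)) x = 2 *: A.
Proof.
move=> d0 As; apply/matrixP => i j; rewrite !mxE.
have -> : diffq d j (fun y => qform A (y - z)) = fun y => 2 * ((y - z) *m A) 0 j.
  apply/funext => y; rewrite /diffq [y + _ - z]addrAC [y - _ - z]addrAC -scaleNr.
  rewrite !qform_line // mul_delta; field; exact: lt0r_neq0.
rewrite (_ : diffq d i _ = fun=> 2 * A i j) ?mollify_cst //.
apply/funext => y; rewrite /diffq [y + _ - z]addrAC [y - _ - z]addrAC.
rewrite !(mulmxBl, mulmxDl) -!scalemxAl -!rowE !mxE.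
field; exact: lt0r_neq0.
Qed.

(** Range of dependence: every average and each of the two difference quotients reaches [d]
    further. *)
Lemma moll_hess_local d f g x : 0 < d -> continuous f -> continuous g ->
  (forall y, `|y - x| <= d *+ (size (@twice n)).+2 -> f y = g y) ->
  moll_hess d f x = moll_hess d g x.
Proof.
move=> d0 cf cg fg; apply/matrixP => i j; rewrite !mxE.
have E y : `|y - x| <= d *+ size (rem i (rem j (@twice n))) ->
    diffq d i (diffq d j f) y = diffq d i (diffq d j g) y.
  move=> yx; have H (a b : R) : `|a| <= d -> `|b| <= d ->
      f (y + a *: delta_mx 0 i + b *: delta_mx 0 j) =
      g (y + a *: delta_mx 0 i + b *: delta_mx 0 j).
    move=> ad bd; apply: fg; rewrite -[y + _ + _]addrA [X in `|X|]addrAC.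
    apply: le_trans (ler_normD _ _) _; rewrite !mulrS addrA [leRHS]addrC lerD //.
      apply: le_trans yx _; rewrite -!(mulr_natr d) ler_pM2l // ler_nat.
      by apply: leq_trans (size_subseq (rem_subseq _ _)) (size_subseq (rem_subseq _ _)).
    by apply: le_trans (ler_normD _ _) _; rewrite lerD //;
      apply: le_trans (normr_scale_delta _ _) _.
  have dd : `|d| <= d by rewrite gtr0_norm.
  have Nd : `|- d| <= d by rewrite normrN.
  have h1 := H _ _ dd dd; have h2 := H _ _ dd Nd.
  have h3 := H _ _ Nd dd; have h4 := H _ _ Nd Nd.
  by rewrite /diffq -!scaleNr h1 h2 h3 h4.
by apply/le_anti/andP; split; apply: mollify_le => //; try exact: diffq_continuous2;
  move=> y /E ->.
Qed.

Lemma closed_ball_compact x (r : R) : compact [set y | `|y - x| <= r].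
Proof.
apply: bounded_closed_compact.
  exists (`|x| + r); split => [|M /ltW rM y /= yx]; first exact: num_real.
  apply: le_trans rM; rewrite -[y](subrK x) addrC.
  by apply: le_trans (ler_normD _ _) _; rewrite lerD.
have : closed ((fun y => `|y - x|) @^-1` [set t : R | t <= r]).
  apply: closed_comp; last exact: closed_le.
  move=> y _; apply: (@cvg_norm _ _ _ (nbhs y) _ (fun y => y - x) (y - x)).
  by apply: cvgB; [exact: cvg_id|exact: cvg_cst].
by [].
Qed.

Lemma qform1_le x : qform 1%:M x <= n%:R * `|x| ^+ 2.
Proof.
rewrite qform1E.
have -> : n%:R * `|x| ^+ 2 = \sum_(i < n) `|x| ^+ 2.
  by rewrite sumr_const card_ord mulr_natl.
apply: ler_sum => i _; rewrite -real_normK ?num_real // ler_pXn2r ?nnegrE //.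
rewrite [leRHS]/Num.norm /= mx_normrE.
exact: (le_bigmax _ (fun ij => `|x ij.1 ij.2|) (0, i)).
Qed.

Lemma continuous_max0 f : continuous f -> continuous (fun y => Num.max 0 (f y)).
Proof.
move=> /continuous_distP cf; apply/continuous_distP => x e /(cf x)[r r0 H].
exists r => // y /H; rewrite !ler_norml => /andP[h1 h2].
have [h3|h3] := leP 0 (f y); have [h4|h4] := leP 0 (f x); apply/andP; split; lra.
Qed.

(* A paraboloid opening downwards replaces w away from x0, which reduces the
   local statement to a compactly supported one. *)
Lemma moll_supersolution (bs : seq 'rV[R]_n) w x0 (B rho d : R) :
  (0 < size bs)%N -> continuous w -> (forall x, - B <= w x) -> 0 < rho -> 0 < d ->
  d *+ (size (@twice n)).+2 <= rho / (3 * (1 + n%:R)) ->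
  (forall x phi H, `|x - x0| < rho -> has_hessian phi H ->
    (forall y, H y \is symmetricmx) -> phi x = w x -> (forall y, phi y <= w y) ->
    elliptic_form bs (H x) <= 0) ->
  elliptic_form bs (moll_hess d w x0) <= 0.
Proof.
move=> bs0 cw wB rho0 d0 dr visc.
pose r := rho / 3; have r0 : 0 < r by rewrite divr_gt0.
pose K := [set y | `|y - x0| <= 2 * r].
have cK : compact K by exact: closed_ball_compact.
have Kx0 : K x0 by rewrite /K /= subrr normr0 mulr_ge0 // ltW.
have [|xm _ wM] := compact_continuous_max cK _ cw; first by exists x0.
set M := w xm in wM.
have MB : 0 <= M + B by have := wB xm; rewrite -/M; lra.
(* The paraboloid [g] is nonnegative where the quadratic form is at most [r ^+ 2], and at most
   [- (M + B)] off [K], where the form is at least [4 * r ^+ 2]. So [f] is nonnegative near [x0] and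
   nonpositive off [K]. *)
pose C := (M + B) / (3 * r ^+ 2).
have r2 : 0 < 3 * r ^+ 2 by rewrite mulr_gt0 // exprn_gt0.
have C0 : 0 <= C by rewrite divr_ge0 // ltW.
have CE : C * (3 * r ^+ 2) = M + B by rewrite divfK // gt_eqF.
pose I2 : 'M[R]_n := 2 *: 1%:M.
have Is : (1%:M : 'M[R]_n) \is symmetricmx by exact: symmetricmx1.
have hq : has_hessian (fun y => qform 1%:M (y + - x0)) (fun=> I2).
  exact: (has_hessian_shift (- x0) (has_hessian_qform Is)).
pose g y := - C * qform 1%:M (y + - x0) + C * r ^+ 2.
have hg : has_hessian g (fun=> - C *: I2 + 0).
  exact: has_hessianD (has_hessianZ (- C) hq) (has_hessian_cst _).
pose f y := g y + (-1 * w y + M).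
have cg := has_hessian_continuous hg.
have cNw := continuous_scale (-1) cw.
have cM : continuous (fun _ : 'rV[R]_n => M) := @cst_continuous _ _ M.
have cNwM := continuous_add cNw cM.
have cf : continuous f := continuous_add cg cNwM.
pose k y := Num.max 0 (f y).
have ck : continuous k := continuous_max0 cf.
pose c := C * elliptic_form bs I2.
have c0 : 0 <= c.
  rewrite mulr_ge0 // /I2 elliptic_formZ mulr_ge0 // sumr_ge0 // => b _.
  exact: qform1_ge0.
have kK x : ~ K x -> k x = 0.
  move=> /negP; rewrite -ltNge => xfar; apply/max_idPl.
  have q4 : 4 * r ^+ 2 <= qform 1%:M (x + - x0).
    apply: le_trans (norm_le_qform1 _); rewrite (_ : 4 * r ^+ 2 = (2 * r) ^+ 2); last by ring.
    by rewrite ler_pXn2r ?nnegrE ?mulr_ge0 ?(ltW r0) // ltW.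
  have := ler_wpM2l C0 q4; have := wB x; move: CE; rewrite /f /g; lra.
have vk psi H x : has_hessian psi H -> (forall y, H y \is symmetricmx) ->
    0 < k x -> (forall y, k y - psi y <= k x - psi x) ->
    - c <= elliptic_form bs (H x).
  move=> hpsi Hs kx mx.
  have kxE : k x = f x by move: kx; rewrite /k; have [//|_] := leP 0 (f x); rewrite ltxx.
  have xx0 : `|x - x0| < rho.
    have : K x by apply: contrapT => /kK kx0; move: kx; rewrite kx0 ltxx.
    by rewrite /K /= /r; lra.
  (* This lies below [w] because [f <= k], and touches it at [x] because [k x], being positive,
     equals [f x]. *)
  pose phi y := g y + (-1 * psi y + (M - (k x - psi x))).
  have hphi : has_hessian phi (fun y => (- C *: I2 + 0) + (-1 *: H y + 0)).
    exact: has_hessianD hg (has_hessianD (has_hessianZ _ hpsi) (has_hessian_cst _)).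
  have : elliptic_form bs ((- C *: I2 + 0) + (-1 *: H x + 0)) <= 0.
    apply: visc hphi _ _ _ => // [y||y].
    - rewrite !addr0; apply/symmetricmxP; rewrite linearD /=.
      rewrite -(symmetricmxP _ (symmetricmxZ _ (symmetricmxZ _ Is))).
      by rewrite -(symmetricmxP _ (symmetricmxZ _ (Hs y))).
    - by rewrite /phi kxE /f; ring.
    - have := mx y; have : f y <= k y by rewrite /k le_max lexx orbT.
      by rewrite /phi /f; lra.
  by rewrite !addr0 elliptic_formD !elliptic_formZ -/I2 -elliptic_formZ /c; lra.
have k0 y : 0 <= k y by rewrite /k le_max lexx.
have := moll_subsolution bs0 c0 d0 ck k0 cK kK vk x0.
have -> : moll_hess d k x0 = - C *: I2 + -1 *: moll_hess d w x0.
  rewrite (@moll_hess_local d k f) // => [|y yx0].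
    have hqE : moll_hess d (fun y => qform 1%:M (y + - x0)) x0 = I2.
      exact: moll_hess_qform.
    have cq := has_hessian_continuous hq.
    rewrite /f moll_hessD // (moll_hessD _ d0 cNw cM) moll_hessZ // moll_hess_cst // addr0.
    rewrite /g moll_hessD //; last exact: cst_continuous.
      by rewrite (moll_hess_cst (C * r ^+ 2)) // addr0 (moll_hessZ (- C) _ d0 cq) hqE.
    exact: continuous_scale.
  (* The radius of dependence is measured in the supremum norm; the factor [1 + n%:R] turns it into
     the bound [r ^+ 2] on the Euclidean form. *)
  have n1 : 0 < 1 + n%:R :> R by rewrite ltr_wpDr.
  have yr : `|y - x0| <= r / (1 + n%:R).
    apply: le_trans yx0 _; apply: le_trans dr _.
    by rewrite /r (_ : rho / 3 / _ = rho / (3 * (1 + n%:R))) //; field; exact: lt0r_neq0.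
  have nr : r / (1 + n%:R) <= r by rewrite ler_pdivrMr // ler_peMr ?(ltW r0) // lerDl.
  have yK : K y by rewrite /K /=; lra.
  have qr : qform 1%:M (y + - x0) <= r ^+ 2.
    apply: le_trans (qform1_le _) _.
    have : `|y - x0| ^+ 2 <= (r / (1 + n%:R)) * r.
      by rewrite expr2; apply: ler_pM => //; exact: le_trans nr.
    rewrite mulrAC ler_pdivlMr // -expr2 => h; apply: le_trans h.
    by rewrite mulrC ler_wpM2l ?sqr_ge0 // lerDr.
  by apply/max_idPr; have := wM y yK; have := ler_wpM2l C0 qr; rewrite /f /g; lra.
(* The paraboloid contributes exactly [- c] to the form, which cancels the constant of the
   subsolution inequality. *)
rewrite elliptic_formD !elliptic_formZ /c /I2 elliptic_formZ; lra.
Qed.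
End LocalSupersolution.

(** * Inf-convolution and comparison *)

Section InfConvolution.
Context {R : realType} {n : nat}.
Implicit Types (f w : 'rV[R]_n -> R) (x y z b : 'rV[R]_n) (H : 'rV[R]_n -> 'M[R]_n).

(** At a local maximum small symmetric second differences are nonpositive, which a positive second
    derivative would contradict by continuity. *)
Lemma elliptic_form_local_max (bs : seq 'rV[R]_n) f H x : has_hessian f H ->
  (\forall y \near x, f y <= f x) -> elliptic_form bs (H x) <= 0.
Proof.
move=> fH /nbhs_ballP[r1 /= r10 fle].
apply: sumr_le0 => b _; rewrite leNgt; apply/negP => q0.
have cq : continuous (fun y => qform (H y) b).
  case: fH => g [_ _ cH] _.
  rewrite (_ : (fun _ => _) = fun y => \sum_i \sum_j (b 0 i * b 0 j) * H y i j).
    by do 2 (apply: continuous_bigsum => ?); exact: continuous_scale.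
  apply/funext => y; rewrite qformE; apply: eq_bigr => i _.
  by apply: eq_bigr => j _; ring.
have q2 : 0 < qform (H x) b / 2 by rewrite divr_gt0.
have /continuous_distP/(_ x _ q2)[r2 r20 Hr2] := cq.
pose h := Num.min r1 r2 / (4 * (1 + `|b|)).
have b1 : 0 < 1 + `|b| by rewrite ltr_wpDr.
have h0 : 0 < h by rewrite divr_gt0 ?mulr_gt0 // lt_min r10.
have hb : 3 * h * `|b| < Num.min r1 r2.
  have -> : Num.min r1 r2 = h * (4 * (1 + `|b|)) by rewrite /h divfK // gt_eqF ?mulr_gt0.
  have : 0 <= h * `|b| by rewrite mulr_ge0 // ltW.
  lra.
move: hb; rewrite lt_min => /andP[hb1 hb2].
have hb0 : 0 <= h * `|b| by rewrite mulr_ge0 // ltW.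
have fb (s : R) : `|s| = h -> f (x + s *: b) <= f x.
  move=> sh; apply: fle; rewrite -ball_normE /= opprD addrA subrr sub0r normrN.
  by rewrite normrZ sh; lra.
have [s sh E] := second_difference x b fH h0.
have f1 := fb h (gtr0_norm h0).
have f2 : f (x - h *: b) <= f x by rewrite -scaleNr; apply: fb; rewrite normrN gtr0_norm.
have : 0 < qform (H (x + s *: b)) b.
  have /Hr2 : `|x + s *: b - x| < r2.
    rewrite addrAC subrr add0r normrZ; apply: le_lt_trans hb2.
    by rewrite ler_wpM2r.
  by rewrite ler_norml => /andP[h1 _]; lra.
have hh : 0 < h ^+ 2 by rewrite exprn_gt0.
by move=> /(mulr_gt0 hh); rewrite -E; lra.
Qed.

Lemma qform_shift_continuous (m : R) x : continuous (fun y => m * qform 1%:M (x - y)).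
Proof.
by apply: continuous_scale; apply: continuous_reflect; exact: qform_continuous.
Qed.

(** Compactness of [K] provides minimizers, collected in [Y]. Continuity of [w] comes from the
    paraboloids alone, which share a modulus at each point as their centres range over [K]. *)
Lemma inf_convolution (K : set 'rV[R]_n) f (m : R) : compact K -> K !=set0 ->
  (forall y (a : R), K y -> a < f y -> \forall y' \near y, K y' -> a < f y') ->
  exists w (Y : 'rV[R]_n -> 'rV[R]_n), [/\ continuous w, forall x, K (Y x),
    forall x, w x = f (Y x) + m * qform 1%:M (x - Y x) &
    forall x y, K y -> w x <= f y + m * qform 1%:M (x - y)].
Proof.
move=> cK K0 lsc.
have /choice[Y HY] : forall x, exists y, K y /\ forall z, K z ->
    f y + m * qform 1%:M (x - y) <= f z + m * qform 1%:M (x - z).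
  move=> x; pose h y := - (f y + m * qform 1%:M (x - y)).
  have [|y Ky my] := @compact_usc_max _ _ _ K h cK K0; last first.
    by exists y; split => // z /my; rewrite lerN2.
  move=> y z Ky Kz; rewrite ltrN2 => yz.
  pose e := (f y + m * qform 1%:M (x - y) - (f z + m * qform 1%:M (x - z))) / 2.
  have e0 : 0 < e by rewrite divr_gt0 // subr_gt0.
  have fe : f y - e < f y by rewrite ltrBlDr ltrDl.
  have qe : m * qform 1%:M (x - y) - e < m * qform 1%:M (x - y) by rewrite ltrBlDr ltrDl.
  near=> y' => Ky'; rewrite /h ltrN2.
  have h1 : f y - e < f y' by move: Ky'; near: y'; exact: lsc.
  have h2 : m * qform 1%:M (x - y) - e < m * qform 1%:M (x - y').
    near: y'; exact: (@qform_shift_continuous m x y) _ (lt_nbhsr qe).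
  move: h1 h2; rewrite /e; lra.
pose w x := f (Y x) + m * qform 1%:M (x - Y x).
have wle x y : K y -> w x <= f y + m * qform 1%:M (x - y) by case: (HY x) => _; exact.
exists w, Y; split=> //; last by move=> x; case: (HY x).
apply/continuous_distP => x e e0.
pose K' := (fun y => x - y) @` K.
have cK' : compact K'.
  apply: continuous_compact => //; apply: continuous_subspaceT; exact: sub_continuous.
pose q z : R := m * qform 1%:M z.
have cq : continuous q by apply: continuous_scale; exact: qform_continuous.
have [r r0 Hr] := continuous_uniform_near_compact cK' cq e0.
exists r => // x' xx'.
have qd y : K y -> `|q (x' - y) - q (x - y)| <= e.
  move=> Ky; apply: Hr; first by exists y.
  by rewrite opprB addrA subrK.
have [KY _] := HY x; have [KY' _] := HY x'.
have := wle x' _ KY; have := wle x _ KY'.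
have := qd _ KY; have := qd _ KY'; rewrite /w /q.
by rewrite !ler_norml => /andP[? ?] /andP[? ?] ? ?; apply/andP; split; lra.
Unshelve. all: by end_near. Qed.

End InfConvolution.

Section Subspace.
Context {R : realType} {n : nat}.
Implicit Types (Omega : set 'rV[R]_n) (x : 'rV[R]_n).

Lemma subspace_nbhs Omega x (V : set 'rV[R]_n) : Omega x ->
  nbhs (x : subspace Omega) V -> \forall y \near x, Omega y -> V y.
Proof. by move=> Ox; change (nbhs_subspace (x : subspace Omega) V -> within Omega (nbhs x) V);
  rewrite nbhs_subspace_in. Qed.

Lemma lsc_near Omega (u : 'rV[R]_n -> \bar R) x (a : R) :
  lower_semicontinuous (u : subspace Omega -> \bar R) -> Omega x ->
  (a%:E < u x)%E -> \forall y \near x, Omega y -> (a%:E < u y)%E.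
Proof.
move=> lsc Ox /lsc[V nV HV]; apply: filterS (subspace_nbhs Ox nV).
by move=> y h /h; exact: HV.
Qed.

Lemma usc_near Omega (v : 'rV[R]_n -> \bar R) x (a : R) :
  upper_semicontinuous (v : subspace Omega -> \bar R) -> Omega x ->
  (v x < a%:E)%E -> \forall y \near x, Omega y -> (v y < a%:E)%E.
Proof.
move=> usc Ox /usc[V nV HV]; apply: filterS (subspace_nbhs Ox nV).
by move=> y h /h; exact: HV.
Qed.

End Subspace.

Lemma C2_near_has_hessian {R : realType} {n : nat} (f : 'rV[R]_n -> R) H x :
  has_hessian f H -> C2_near x f /\ hessian f x = H x.
Proof.
move=> /has_hessian_C2[fC2 fH]; split; last exact: fH.
by exists setT => //; split => //; exact: openT.
Qed.

Lemma compact_thickening {R : realType} {n : nat} (K : set 'rV[R]_n) (r : R) :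
  compact K -> compact [set y | exists2 x, K x & `|y - x| <= r].
Proof.
move=> cK.
rewrite (_ : [set _ | _] =
  (fun p : 'rV[R]_n * 'rV[R]_n => p.1 + p.2) @` (K `*` [set z | `|z - 0| <= r])).
  apply: continuous_compact.
    by apply: continuous_subspaceT => p; exact: add_continuous.
  by apply: compact_setX => //; exact: closed_ball_compact.
apply/seteqP; split => y /=.
  by move=> [x Kx yx]; exists (x, y - x); rewrite /= ?subr0 // addrC subrK.
by move=> [[x z] /= [Kx zr] <-]; exists x => //; rewrite addrAC subrr add0r -[z]subr0.
Qed.

(** * From the inf-convolution to the comparison principle *)

Section Comparison.
Context {R : realType} {n : nat}.
Variables (F : 'M[R]_n -> R).
Hypotheses (Fell : degenerate_elliptic F) (Fsub : sublinear F).
Implicit Types (x y z : 'rV[R]_n).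

(* Test functions below w are transported from x to the point Y x realizing the
   infimum; where the truncation at Lam is active they have a local maximum. *)
Lemma inf_convolution_supersolution (bs : seq 'rV[R]_n) (Omega : set 'rV[R]_n)
    (u : 'rV[R]_n -> \bar R) (ut w : 'rV[R]_n -> R) (Lam m : R) (K : set 'rV[R]_n) x y0 :
  (forall X, X \is symmetricmx -> elliptic_form bs X <= F X) ->
  viscosity_supersolution F Omega u -> Omega y0 ->
  (forall y, Omega y -> (ut y)%:E = Order.min (u y) Lam%:E) ->
  K `<=` Omega -> (\forall y \near y0, K y) ->
  w x = ut y0 + m * qform 1%:M (x - y0) ->
  (forall z y, K y -> w z <= ut y + m * qform 1%:M (z - y)) ->
  forall phi H, has_hessian phi H -> (forall y, H y \is symmetricmx) ->
    phi x = w x -> (forall y, phi y <= w y) -> elliptic_form bs (H x) <= 0.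
Proof.
move=> bsF [_ _ _ uvis] Oy0 utE KO Ky0 wx wle phi H hphi Hs phix phile.
pose q := m * qform 1%:M (x - y0).
pose psi y := phi (y + (x - y0)) + - q.
have hpsi : has_hessian psi (fun y => H (y + (x - y0)) + 0).
  exact: has_hessianD (has_hessian_shift _ hphi) (has_hessian_cst _).
have psi0 : psi y0 = ut y0 by rewrite /psi subrKC phix wx /q addrK.
have psile y : K y -> psi y <= ut y.
  move=> Ky; rewrite /psi lerBlDr; apply: le_trans (phile _) _.
  have := wle (y + (x - y0)) y Ky.
  by rewrite (_ : y + (x - y0) - y = x - y0) // addrAC subrr add0r.
have HE : H (y0 + (x - y0)) + 0 = H x by rewrite addr0 subrKC.
have utle y : K y -> ((ut y)%:E <= u y)%E /\ ut y <= Lam.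
  move=> /KO/utE E; split; first by rewrite E ge_min lexx.
  by rewrite -lee_fin E ge_min lexx orbT.
have Ky00 : K y0 by exact: nbhs_singleton Ky0.
have [uL|Lu] := leP (u y0) Lam%:E.
  have [C2 hE] := C2_near_has_hessian y0 hpsi.
  have : F (hessian psi y0) <= 0.
    apply: uvis => //.
      by rewrite psi0 utE // (min_idPl uL).
    apply: filterS Ky0 => y Ky; apply: le_trans (utle y Ky).1.
    by rewrite lee_fin psile.
  by rewrite hE HE; apply: le_trans; exact: bsF.
have utL : ut y0 = Lam by apply: EFin_inj; rewrite utE // (min_idPr (ltW Lu)).
rewrite -HE; apply: (elliptic_form_local_max bs hpsi).
apply: filterS Ky0 => y Ky; rewrite psi0 utL.
by apply: le_trans (psile y Ky) (utle y Ky).2.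
Qed.

(** The directions are chosen for the single matrix [moll_hess d w x0], at which their functional
    touches [F]; this is why the hypothesis ranges over all minorants. *)
Lemma moll_supersolution_le0 (w : 'rV[R]_n -> R) (B rho d : R) x0 :
  continuous w -> (forall x, - B <= w x) -> 0 < rho -> 0 < d ->
  d *+ (size (@twice n)).+2 <= rho / (3 * (1 + n%:R)) ->
  (forall bs, (forall X, X \is symmetricmx -> elliptic_form bs X <= F X) ->
    forall x phi H, `|x - x0| < rho -> has_hessian phi H ->
    (forall y, H y \is symmetricmx) -> phi x = w x -> (forall y, phi y <= w y) ->
    elliptic_form bs (H x) <= 0) ->
  F (moll_hess d w x0) <= 0.
Proof.
move=> cw wB rho0 d0 dr visc.
have [bs [bsF <-]] := elliptic_sublinear_support Fell Fsub (moll_hess_sym d w x0).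
(* A walk requires a direction; for an empty list the supporting functional, and with it the value
   of [F], is zero. *)
have [/eqP/nilP ->|bs0] := posnP (size bs); first by rewrite big_nil.
exact: (moll_supersolution bs0 cw wB rho0 d0 dr (visc bs bsF)).
Qed.

End Comparison.

Unset Implicit Arguments.

Theorem theorem2p3p4 (R : realType) (n : nat) (hn : (2 <= n)%N)
    (F : 'M[R]_n -> R)
    (Fell : degenerate_elliptic F) (Fsub : sublinear F)
    (Fneg : exists2 X : 'M[R]_n, X \is symmetricmx & F X < 0)
    (Omega : set 'rV[R]_n) (Omega0 : Omega !=set0) (Omega_open : open Omega)
    (u v : 'rV[R]_n -> \bar R)
    (usup : viscosity_supersolution F Omega u)
    (vsub : viscosity_subsolution F Omega v)
    (D : set 'rV[R]_n) (DOmega : compactly_contained D Omega) :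
  (forall x, boundary D x -> (v x <= u x)%E) ->
  forall x, D x -> (v x <= u x)%E.
Proof.
move=> vu x1 Dx1; rewrite leNgt; apply/negP => uv1.
have [cD DO] := DOmega; have [X0 X0s FX0] := Fneg.
have [u_ninf ulsc _ _] := usup; have [v_pinf vusc _ vvis] := vsub.
pose K0 := closure D.
have K0D : D `<=` K0 := @subset_closure _ D.
have K0x1 : K0 x1 := K0D _ Dx1.
have Ox1 : Omega x1 := DO _ K0x1.
have nearO y : Omega y -> \forall y' \near y, Omega y'.
  by move=> Oy; exact: open_nbhs_nbhs.
have real_of y z : Omega y -> Omega z -> (v y < v z)%E -> exists a, v z = a%:E.
  move=> Oy Oz; have := v_pinf z Oz; case: (v z) => // [a|]; first by exists a.
  by rewrite ltNge leNye.
have [v1 v1E] : exists a, v x1 = a%:E.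
  have := v_pinf _ Ox1; move: uv1; case: (v x1) => // [a|]; first by exists a.
  by rewrite ltNge leNye.
have [u1 u1E] : exists a, u x1 = a%:E.
  have := u_ninf _ Ox1; move: uv1; rewrite v1E; case: (u x1) => // a; by exists a.
have uv1' : u1 < v1 by rewrite -lte_fin -u1E -v1E.
have [||xm K0m vM] := @compact_usc_max _ _ _ K0 v cD; first by exists x1.
  move=> y z /DO Oy /DO Oz yz; have [a za] := real_of _ _ Oy Oz yz.
  rewrite za in yz *; near=> y' => _.
  have Oy' : Omega y' by near: y'; exact: nearO.
  by move: Oy'; near: y'; exact: usc_near.
have [Lam LamE] : exists a, v xm = a%:E.
  have := vM _ K0x1; have := v_pinf _ (DO _ K0m); rewrite v1E.
  by case: (v xm) => // a; exists a.
have vLam y : K0 y -> (v y <= Lam%:E)%E by move=> /vM; rewrite LamE.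
(* In [Omega] the minimum is finite, so [fine] loses nothing there. On the boundary [v <= ut]
   persists because [v <= Lam]. *)
pose ut y : R := fine (Order.min (u y) Lam%:E).
have utE y : Omega y -> (ut y)%:E = Order.min (u y) Lam%:E.
  move=> /u_ninf; rewrite /ut; case: (u y) => // a _.
  by rewrite -EFin_min.
have ut_le y : Omega y -> ((ut y)%:E <= u y)%E /\ ut y <= Lam.
  move=> /utE E; split; first by rewrite E ge_min lexx.
  by rewrite -lee_fin E ge_min lexx orbT.
have ut_lsc y (a : R) : Omega y -> a < ut y ->
    \forall y' \near y, Omega y' -> a < ut y'.
  move=> Oy; rewrite -lte_fin utE // lt_min => /andP[au aL].
  have := lsc_near ulsc Oy au; apply: filterS => y' h Oy'.
  by rewrite -lte_fin utE // lt_min aL h.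
have ut1 : ut x1 = u1.
  apply: EFin_inj; rewrite utE // u1E -EFin_min; congr _%:E; apply/min_idPl.
  by have := vLam _ K0x1; rewrite v1E lee_fin; lra.
have [rho0 rho00 Hrho0] : exists2 r : R, 0 < r &
    forall x y, K0 x -> ball x r y -> Omega y.
  apply: compact_uniform => // z /DO /nearO/nbhs_ballP[r r0 H].
  by exists r => // x y _; exact: H.
pose rho := rho0 / 2; have rho_gt0 : 0 < rho by rewrite divr_gt0.
(* Room around the closure of [D], so that minimizers belonging to points close to it are interior
   to [K]. *)
pose K := [set y | exists2 x, K0 x & `|y - x| <= rho].
have cK : compact K by exact: compact_thickening.
have KO : K `<=` Omega.
  move=> y [x K0x yx]; apply: (Hrho0 x) => //.
  rewrite -ball_normE /= distrC; apply: le_lt_trans yx _; rewrite /rho; lra.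
have K0K : K0 `<=` K by move=> x K0x; exists x => //; rewrite subrr normr0 ltW.
have Kn0 : K !=set0 by exists x1; exact: K0K.
have utK_lsc y (a : R) : K y -> a < ut y -> \forall y' \near y, K y' -> a < ut y'.
  move=> /KO Oy ay; have := ut_lsc y a Oy ay.
  by apply: filterS => y' h /KO; exact: h.
have [B utB] : exists B, forall y, K y -> - B <= ut y.
  have [|yb Kb Hb] := @compact_usc_max _ _ _ K (fun y => - ut y) cK Kn0.
    move=> y z Ky Kz; rewrite ltrN2 => zy.
    have := utK_lsc y _ Ky zy; apply: filterS => y' h Ky'.
    by rewrite ltrN2 h.
  by exists (- ut yb) => y /Hb; rewrite opprK lerN2.
have LB : 0 <= Lam + B.
  by have := utB _ (K0K _ K0x1); have := (ut_le _ Ox1).2; lra.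
have [P P0 HP] : exists2 P, 0 < P & forall y, K0 y -> `|qform X0 y| <= P.
  have cn : continuous (fun y => `|qform X0 y|).
    have /continuous_distP cq := @qform_continuous _ _ X0.
    apply/continuous_distP => x e /(cq x)[r r0 H]; exists r => // y /H.
    exact: le_trans (ler_dist_dist _ _).
  have [|xp _ Hp] := compact_continuous_max cD _ cn; first by exists x1.
  exists (1 + `|qform X0 xp|); first by rewrite ltr_wpDr.
  by move=> y /Hp h; apply: le_trans h _; rewrite lerDr.
(* At [x1] the difference of [v] and [G] keeps at least 6 of the 8 parts, after one for
   mollification and one for the perturbation by [X0]; on the boundary it stays below 3. *)
pose sig := (v1 - u1) / 8.
have sig0 : 0 < sig by rewrite divr_gt0 // subr_gt0.
pose delta := sig / P.
have delta0 : 0 < delta by rewrite divr_gt0.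
have pb y : K0 y -> `|delta * qform X0 y| <= sig.
  move=> /HP h; rewrite normrM gtr0_norm // /delta mulrAC ler_pdivrMr //.
  by rewrite ler_wpM2l // ltW.
have BdK0 : boundary D `<=` K0 by move=> y [].
have cB : compact (boundary D).
  rewrite /boundary setDE; apply: compact_closedI => //.
  by apply: open_closedC; exact: open_interior.
(* The points [x] and [y] are decoupled because the minimizer of a boundary point need not lie on
   the boundary. *)
have [rho1 rho10 Hrho1] : exists2 r : R, 0 < r &
    forall x y, boundary D x -> ball x r y -> K y -> (v x < (ut y + sig)%:E)%E.
  apply: compact_uniform => // z Bz.
  have Oz : Omega z by apply: DO; exact: BdK0.
  have vz : (v z < (ut z + sig / 2)%:E)%E.
    apply: (@le_lt_trans _ _ (ut z)%:E).
      by rewrite utE // le_min vu // vLam //; exact: BdK0.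
    by rewrite lte_fin ltrDl divr_gt0.
  have uz : ut z - sig / 2 < ut z by rewrite ltrBlDr ltrDl divr_gt0.
  have /nbhs_ballP[r1 r10 H1] := usc_near vusc Oz vz.
  have /nbhs_ballP[r2 r20 H2] := ut_lsc z _ Oz uz.
  have /nbhs_ballP[r3 r30 H3] := nearO z Oz.
  exists (Num.min r1 (Num.min r2 r3)); first by rewrite !lt_min r10 r20.
  move=> x y zx zy Ky.
  have Ox : Omega x by apply: H3; apply: le_ball zx; rewrite !ge_min lexx !orbT.
  have := H1 x _ Ox; have := H2 y _ (KO _ Ky).
  have r2' : Num.min r1 (Num.min r2 r3) <= r2 by rewrite !ge_min lexx !orbT.
  have r1' : Num.min r1 (Num.min r2 r3) <= r1 by rewrite !ge_min lexx.
  move=> /(_ (le_ball r2' zy)) h2 /(_ (le_ball r1' zx)) h1.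
  by apply: lt_trans h1 _; rewrite lte_fin; lra.
(* [rho1] serves the boundary comparison, [rho / 4] keeps minimizers interior to [K]. *)
pose rho2 := Num.min rho1 (rho / 4).
have rho20 : 0 < rho2 by rewrite lt_min rho10 divr_gt0.
(* At distance [rho2] the penalty exceeds [Lam + B], the most that [ut] can vary over [K]. *)
pose m := (Lam + B + 1) / rho2 ^+ 2.
have m0 : 0 < m by rewrite divr_gt0 ?exprn_gt0 //; lra.
have [w [Y [cw KY wE wle]]] := @inf_convolution _ _ K ut m cK Kn0 utK_lsc.
have wut x : K x -> w x <= ut x.
  by move=> /(wle x); rewrite subrr /qform mul0mx mul0mx mxE mulr0 addr0.
have q_ge0 x : 0 <= m * qform 1%:M (x - Y x) by rewrite mulr_ge0 ?qform1_ge0 ?ltW.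
have wB x : - B <= w x by rewrite wE; have := utB _ (KY x); have := q_ge0 x; lra.
have Yclose x : K x -> `|x - Y x| < rho2.
  move=> Kx; rewrite ltNge; apply/negP => far.
  have h1 : m * rho2 ^+ 2 <= m * qform 1%:M (x - Y x).
    rewrite ler_wpM2l ?(ltW m0) // (le_trans _ (norm_le_qform1 _)) //.
    by rewrite ler_pXn2r ?nnegrE ?(ltW rho20).
  have h2 := wut x Kx; have h3 := (ut_le _ (KO _ Kx)).2; have h4 := utB _ (KY x).
  move: h1; rewrite /m divfK ?expf_neq0 ?gt_eqF // -/m => h1.
  by move: h2; rewrite wE; lra.
have v_lt_w x : boundary D x -> (v x < (w x + sig)%:E)%E.
  move=> Bx; have Kx : K x by apply: K0K; exact: BdK0.
  have : (v x < (ut (Y x) + sig)%:E)%E.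
    apply: Hrho1 => //; rewrite -ball_normE /=; apply: lt_le_trans (Yclose x Kx) _.
    by rewrite ge_min lexx.
  move=> h; apply: lt_le_trans h _; rewrite lee_fin wE; have := q_ge0 x; lra.
have [r4 r40 Hr4] := continuous_uniform_near_compact cD cw sig0.
pose N : R := (size (@twice n)).+2%:R.
have N0 : 0 < N by rewrite ltr0n.
(* The first bound is the one required by the local inequality at radius [rho / 2], the second keeps
   [V] within [sig] of [w]; [N] counts the averages and the two difference quotients. *)
pose d := Num.min (rho / 2 / (3 * (1 + n%:R))) (r4 / 2) / N.
have n1 : 0 < 1 + n%:R :> R by rewrite ltr_wpDr.
have d0 : 0 < d.
  by rewrite divr_gt0 // lt_min !divr_gt0 // mulr_gt0.
have dN : d *+ (size (@twice n)).+2 =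
    Num.min (rho / 2 / (3 * (1 + n%:R))) (r4 / 2).
  by rewrite -mulr_natr divfK // gt_eqF.
pose V := moll d w.
have Vw x : K0 x -> `|V x - w x| <= sig.
  move=> K0x; apply: (@moll_near _ _ _ _ _ r4) => //.
    have h1 : d *+ (size (@twice n)).+2 <= r4 / 2 by rewrite dN ge_min lexx orbT.
    apply: (@le_lt_trans _ _ (r4 / 2)); last by rewrite ltr_pdivrMr // ltr_pMr // ltr1n.
    apply: le_trans h1; rewrite -!(mulr_natr d) ler_pM2l // ler_nat.
    exact: leq_trans (leqnSn _) (leqnSn _).
  by move=> y; exact: Hr4.
have FV x : K0 x -> F (moll_hess d w x) <= 0.
  move=> K0x; apply: (@moll_supersolution_le0 _ _ F Fell Fsub w B (rho / 2)) => //.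
  - by rewrite divr_gt0.
  - by rewrite dN ge_min lexx.
  move=> bs bsF y phi H yx.
  have Ky : K y by exists x => //; apply: ltW; move: yx; have := rho_gt0; lra.
  (* Distances add up to [rho]: at most [rho / 2] from [x] to [y], [rho / 4] from [y] to [Y y], and
     [rho / 4] for the neighbourhood. *)
  have nK : \forall z \near Y y, K z.
    apply/nbhs_ballP; exists (rho / 4); first by rewrite /= divr_gt0.
    move=> z; rewrite -ball_normE /= => Yz; exists x => //.
    have h1 : `|y - Y y| < rho / 4.
      by apply: lt_le_trans (Yclose y Ky) _; rewrite ge_min lexx orbT.
    have -> : z - x = (z - Y y) + (Y y - y) + (y - x) by rewrite !addrA !subrK.
    apply: le_trans (ler_normD _ _) _.
    have h2 := ler_normD (z - Y y) (Y y - y).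
    rewrite [`|Y y - y|]distrC [`|z - Y y|]distrC in h2.
    by move: h1 h2 yx Yz; lra.
  exact: (inf_convolution_supersolution bsF usup (KO _ (KY y)) utE KO nK (wE y) wle).
pose G y : R := V y + delta * qform X0 y.
have hG : has_hessian G (fun y => moll_hess d w y + delta *: (2 *: X0)).
  exact: has_hessianD (moll_has_hessian d0 cw) (has_hessianZ _ (has_hessian_qform X0s)).
have cG := has_hessian_continuous hG.
have [||xs K0s Hs] := @compact_usc_max _ _ _ K0 (fun y => (v y - (G y)%:E)%E) cD.
- by exists x1.
- move=> y z K0y K0z yz.
  have [c vz] : exists c, v z = c%:E.
    have := v_pinf _ (DO _ K0z); move: yz; case: (v z) => // [c|]; first by exists c.
    by rewrite ltNge leNye.
  (* A level strictly between [v y], possibly [-oo], and the threshold; what remains above it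
     absorbs the variation of [G]. *)
  have [a [va aT]] : exists a, (v y < a%:E)%E /\ a < c - G z + G y.
    have := v_pinf _ (DO _ K0y); move: yz; rewrite vz; case: (v y) => // [b|].
      rewrite -!EFinB lte_fin => bc _.
      by exists ((b + (c - G z + G y)) / 2); rewrite lte_fin; split; lra.
    by move=> _ _; exists (c - G z + G y - 1); split; [exact: ltNyr|lra].
  have Gy : G y - (c - G z + G y - a) < G y by lra.
  near=> y' => K0y'; rewrite vz.
  have Oy' := DO _ K0y'.
  have h1 : (v y' < a%:E)%E.
    by move: Oy'; near: y'; apply: usc_near => //; exact: DO.
  have h2 : G y - (c - G z + G y - a) < G y'.
    near: y'; exact: (cG y) _ (lt_nbhsr Gy).
  move: h1; case: (v y') => // [b|_]; last exact: ltNyr.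
  by rewrite -!EFinB !lte_fin => h1; lra.
have h1 : ((6 * sig)%:E <= v xs - (G xs)%:E)%E.
  apply: le_trans (Hs _ K0x1); rewrite v1E -EFinB lee_fin /G.
  have := Vw _ K0x1; have := pb _ K0x1; have := wut _ (K0K _ K0x1).
  rewrite ut1 !ler_norml => h1 /andP[h2 h3] /andP[h4 h5].
  by move: h1 h2 h3 h4 h5; rewrite /sig; lra.
have [vs vsE] : exists a, v xs = a%:E.
  have := v_pinf _ (DO _ K0s); move: h1; case: (v xs) => // a; by exists a.
rewrite vsE -EFinB lee_fin in h1.
have Dxs : interior D xs.
  apply: contrapT => nDs; have := v_lt_w xs (conj K0s nDs).
  rewrite vsE lte_fin; move: h1; have := Vw _ K0s; have := pb _ K0s.
  rewrite /G !ler_norml => /andP[? ?] /andP[? ?]; lra.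
pose phi y := G y + (vs - G xs).
have hphi := has_hessianD hG (has_hessian_cst (vs - G xs)).
have [C2 hE] := C2_near_has_hessian xs hphi.
have : 0 <= F (hessian phi xs).
  apply: vvis => //; first exact: DO.
    by rewrite /phi vsE; congr _%:E; ring.
  apply: filterS Dxs => y Dy; have := Hs y (K0D _ Dy); rewrite vsE /phi.
  have := v_pinf _ (DO _ (K0D _ Dy)); case: (v y) => // [a _|_ _].
    by rewrite -!EFinB !lee_fin; lra.
  exact: leNye.
rewrite hE addr0 => F0.
(* Subadditivity bounds [F] at the Hessian of [phi] by a nonpositive value plus
   [delta * (2 * F X0)], which is strictly negative. *)
have := Fsub.1 _ _ (moll_hess_sym d w xs) (symmetricmxZ delta (symmetricmxZ 2 X0s)).
rewrite !Fsub.2 ?(ltW delta0) //; last exact: symmetricmxZ.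
have := FV _ K0s; have : delta * (2 * F X0) < 0 by rewrite !pmulr_rlt0.
by lra.
Unshelve. all: by end_near. Qed.
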